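(* Let $k$ be a field, $R=k[x_1,\ldots,x_d]$, and let $(G,\alpha)$ be an edge labeled graph with edge labels in $R$. (a) If $G$ contains only one cycle $C_n$ and $\operatorname{rk} C_n\le 2$, then the spline module $R_{(G,\alpha)}$ is a free $R$-module. (b) If $G$ decomposes into disjoint cycles $C_1,\ldots,C_s$ and $p$ free edges, where $\operatorname{rk} C_i\le 2$ for all $i$, then the spline module $R_{(G,\alpha)}$ is a free $R$-module.
   Context: Edge labeled graphs and splines. An edge labeled graph $(G,\alpha)$ over $R$ is a finite graph $G=(V,E)$ with a label $l_e\in R$ on each edge $e$, standing for the principal ideal $\alpha(e)=\langle l_e\rangle$. A generalized spline on $(G,\alpha)$ is a tuple $(f_v)_{v\in V}\in R^{|V|}$ with $f_u-f_v\in\alpha(uv)$ for every edge $uv\in E$. The set of all of them is the $R$-module $R_{(G,\alpha)}\subseteq R^{|V|}$. Rank. For a cycle $C$ with edge labels $l_1,\ldots,l_n\in R$, the rank $\operatorname{rk} C$ is the dimension over $k$ of the $k$-linear span of $l_1,\ldots,l_n$ in $R$. Matrix of a graph. A minimal cycle of $G$ is a cycle that does not contain any smaller cycle (no cycle of smaller length has all its vertices on it). Fix an orientation of the edges and a direction of traversal of each minimal cycle. The matrix $A$ of $(G,\alpha)$ has rows indexed by the minimal cycles $C_i$ and columns indexed by the edges $e_j$, with $A_{ij}=0$ if $e_j\notin C_i$ and $A_{ij}=\pm l_{e_j}$ if $e_j\in C_i$, the sign being determined by the orientation of $e_j$ in $C_i$. If $G$ has no cycles, $A$ is the row matrix $(0,\ldots,0)$.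 Interior, exterior, free edges and removal. An edge is interior if it is contained in two or more (minimal) cycles, exterior if it is contained in exactly one, and free if it is contained in none. An interior edge $e_i$ of a cycle $C$ is removable from $C$ if its label $l_i$ lies in the ideal of $R$ generated by the labels of the exterior edges of $C$. Removing $e_i$ from $C$ means replacing the entry of $A$ in row $C$ and column $e_i$ by $0$; afterwards $e_i$ is regarded as no longer contained in $C$ (but still contained in the other cycles containing it), and the notions interior/exterior/removable for subsequent removals refer to this updated situation. Decomposition. Let $G'$ be obtained from $G$ by a finite (possibly empty) sequence of removals of removable interior edges from cycles. If $(G'',\alpha'')$ is an edge labeled graph (loops and multiple edges allowed, since when an edge is removed from a cycle its endpoints are identified in that cycle) having the same matrix as $G'$, then $G$ is said to decompose into $G''$. ''$G$ decomposes into disjoint cycles $C_1,\ldots,C_s$ and $p$ free edges'' means that $G$ decomposes into such a $G''$ whose cycles are exactly $C_1,\ldots,C_s$ (with labels given by $\alpha''$), no two of which share an edge, and which has exactly $p$ further edges, contained in no cycle. *)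

(* Defs.v *)
From HB Require Import structures.
From mathcomp Require Import all_boot all_order all_algebra.
From mathcomp Require Import boolp.
From mathcomp Require Import mpoly.

Set Implicit Arguments.
Unset Strict Implicit.
Unset Printing Implicit Defensive.

Import GRing.Theory.
Local Open Scope ring_scope.

Section Span.
Context (A : pzRingType) (M : lmodType A) (J : finType).
Variables (F : J -> M) (S : {set J}).

Definition lspan : {pred M} :=
  fun x => `[< exists c : J -> A, x = \sum_(j in S) c j *: F j >].

Lemma lspan_submod : GRing.submod_closed lspan.
Proof.
split.
  apply/asboolP; exists (fun _ => 0).
  by rewrite big1 // => j _; rewrite scale0r.
move=> a x y /asboolP[c ->] /asboolP[c' ->]; apply/asboolP.
exists (fun j => a * c j + c' j); rewrite scaler_sumr -big_split /=.
by apply: eq_bigr => j _; rewrite scalerDl scalerA.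
Qed.

HB.instance Definition _ := GRing.isSubmodClosed.Build A M lspan lspan_submod.

Record lspan_mod := LSpan { lspan_val :> M; _ : lspan_val \in lspan }.

HB.instance Definition _ := [isSub for lspan_val].
HB.instance Definition _ := [Choice of lspan_mod by <:].
HB.instance Definition _ := [SubChoice_isSubLmodule of lspan_mod by <:].

End Span.

Definition ideal_gen (R : comNzRingType) (J : finType) (l : J -> R)
    (S : {set J}) : {pred R} :=
  lspan (l : J -> R^o) S.

Section Basis.
Context (A : pzRingType) (M : lmodType A).

Definition is_basis (I : eqType) (b : I -> M) : Prop :=
  (forall x : M, exists (s : seq I) (c : I -> A), x = \sum_(i <- s) c i *: b i)
  /\ (forall (s : seq I) (c : I -> A), uniq s ->
        \sum_(i <- s) c i *: b i = 0 -> forall i, i \in s -> c i = 0).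

Definition free_module : Prop :=
  exists (I : eqType) (b : I -> M), is_basis b.

Definition has_dim (n : nat) : Prop := exists b : 'I_n -> M, is_basis b.

End Basis.

(* An edge labeled graph, possibly with loops and multiple edges. The
   orientation [src -> tgt] of each edge only serves to fix the signs in the
   matrix of the graph. *)
Record lgraph (R : comNzRingType) := LGraph {
  vertex : finType;
  edge : finType;
  src : edge -> vertex;
  tgt : edge -> vertex;
  lab : edge -> R }.

Section Graph.
Context (R : comNzRingType) (G : lgraph R).
Local Notation V := (vertex G).
Local Notation E := (edge G).

Definition ends (e : E) : {set V} := [set src e; tgt e].

Definition simple_graph : Prop :=
  (forall e : E, src e != tgt e) /\ injective ends.

Definition spline : {pred {ffun V -> R^o}} :=
  fun f => `[< forall e : E,
    f (src e) - f (tgt e) \in ideal_gen (@lab R G) [set e] >].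

Lemma spline_submod : GRing.submod_closed spline.
Proof.
split.
  by apply/asboolP => e; rewrite !ffunE subrr; apply: (lspan_submod _ _).1.
move=> a f g /asboolP hf /asboolP hg; apply/asboolP => e; rewrite !ffunE.
rewrite opprD addrACA -scalerBr.
exact: (lspan_submod _ _).2 _ _ _ (hf e) (hg e).
Qed.

HB.instance Definition _ :=
  GRing.isSubmodClosed.Build R {ffun V -> R^o} spline spline_submod.

Record spline_module :=
  Spline { spline_val :> {ffun V -> R^o}; _ : spline_val \in spline }.

HB.instance Definition _ := [isSub for spline_val].
HB.instance Definition _ := [Choice of spline_module by <:].
HB.instance Definition _ := [SubChoice_isSubLmodule of spline_module by <:].

(* An edge traversed in a given direction: [(e, true)] from [src e] to
   [tgt e], and [(e, false)] the other way. *)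
Definition dart : Type := (E * bool)%type.
Definition dsrc (x : dart) : V := if x.2 then src x.1 else tgt x.1.
Definition dtgt (x : dart) : V := if x.2 then tgt x.1 else src x.1.

(* The distinctness of the edges matters only for length 2, where it excludes
   going back and forth along one edge. Loops and pairs of parallel edges are
   cycles of length 1 and 2. *)
Definition traverses (t : seq dart) (C : {set E}) : bool :=
  [&& t != [::], cycle (fun x y => dtgt x == dsrc y) t, uniq (map dsrc t),
      uniq (map fst t) & C == [set e in map fst t]].

(* A cycle is identified with its set of edges. *)
Definition is_cycle (C : {set E}) : bool :=
  [exists t : #|C|.-tuple dart, traverses t C].

Definition cycles : {set {set E}} := [set C | is_cycle C].

Definition cycle_vertices (C : {set E}) : {set V} := \bigcup_(e in C) ends e.

Definition minimal_cycles : {set {set E}} :=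
  [set C in cycles | [forall D in cycles,
     (#|D| < #|C|)%N ==> ~~ (cycle_vertices D \subset cycle_vertices C)]].

(* The cycles indexing the rows of the matrix; if there are none, the dummy
   empty set indexes a single zero row. *)
Definition row_cycles : {set {set E}} :=
  if minimal_cycles == set0 then [set set0] else minimal_cycles.

Definition row_index : finType := {C : {set E} | C \in row_cycles}.

(* The state of a sequence of removals: [I C] is the set of the edges
   regarded as contained in the minimal cycle [C]. *)
Definition incidence : Type := {ffun {set E} -> {set E}}.

Definition incidence0 : incidence := [ffun C => C].

Definition containing (I : incidence) (e : E) : {set {set E}} :=
  [set C in minimal_cycles | e \in I C].

Definition interior (I : incidence) (e : E) : bool := (1 < #|containing I e|)%N.
Definition exterior (I : incidence) (e : E) : bool := #|containing I e| == 1%N.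

Definition removable (I : incidence) (C : {set E}) (e : E) : Prop :=
  [/\ C \in minimal_cycles, e \in I C, interior I e &
      lab e \in ideal_gen (@lab R G) [set j in I C | exterior I j]].

Definition remove (I : incidence) (C : {set E}) (e : E) : incidence :=
  [ffun D => if D == C then I D :\ e else I D].

Inductive removals : incidence -> incidence -> Prop :=
| removals_refl I : removals I I
| removals_step I C e I' :
    removable I C e -> removals (remove I C e) I' -> removals I I'.

Definition directions (tau : {set E} -> seq dart) : Prop :=
  forall C, C \in minimal_cycles -> traverses (tau C) C.

Definition graph_matrix (tau : {set E} -> seq dart) (I : incidence)
    (i : row_index) (e : E) : R :=
  let C := val i in
  if e \in I C then (if (e, true) \in tau C then lab e else - lab e) else 0.

End Graph.

Arguments incidence0 {R} G.

Definition same_matrix (R : Type) (I J I' J' : finType)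
    (A : I -> J -> R) (B : I' -> J' -> R) : Prop :=
  exists (f : I -> I') (g : J -> J'),
    [/\ bijective f, bijective g & forall i j, B (f i) (g j) = A i j].

Definition decomposes (R : comNzRingType) (G H : lgraph R) : Prop :=
  exists (I : incidence G) (tau : {set edge G} -> seq (dart G))
         (tau' : {set edge H} -> seq (dart H)),
    [/\ removals (incidence0 G) I, directions tau, directions tau' &
        same_matrix (graph_matrix tau I) (graph_matrix tau' (incidence0 H))].

Definition disjoint_cycles_and_free_edges (R : comNzRingType) (H : lgraph R)
    (s : nat) (C : 'I_s -> {set edge H}) (p : nat) : Prop :=
  [/\ forall D : {set edge H}, D \in cycles H <-> exists i, D = C i,
      forall i j, i != j -> [disjoint C i & C j] &
      #|~: \bigcup_i C i| = p].

Definition cycle_rank (k : fieldType) (d : nat) (G : lgraph {mpoly k[d]})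
    (C : {set edge G}) (r : nat) : Prop :=
  has_dim (lspan_mod (@lab _ G : edge G -> ({mpoly k[d]} : lmodType k)) C) r.

Definition cycle_rank_le (k : fieldType) (d : nat) (G : lgraph {mpoly k[d]})
    (C : {set edge G}) (n : nat) : Prop :=
  exists2 r, cycle_rank C r & (r <= n)%N.

(* Main.v *)
From HB Require Import structures.
Require Import Defs.
From mathcomp Require Import all_boot all_order all_algebra.
From mathcomp Require Import boolp.
From mathcomp Require Import mpoly.
From mathcomp Require Import ring.

(** Why the theorem is true.

    A spline is determined, up to a function that is constant on each
    connected component, by its differences along the edges, and these are
    l_e g_e for a vector g of coefficients.  A vector of edge values comes from
    a function on the vertices if and only if its signed sum around every cycle
    vanishes; in a simple graph a non-minimal cycle has a chord, which splits
    it into two shorter cycles, so the minimal cycles suffice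
    ([exact_on_cycles], [exact_from_cycles]).  Hence the spline module is an
    extension of the free module of relations g killed by the matrix of the
    graph by the free module of locally constant functions, provided that g is
    normalised to vanish on the edges with label 0, whose coefficients are
    arbitrary ([spline_finite_free]).  Freeness of the kernel of the matrix,
    restricted to the columns of nonzero label, is what remains to be shown.

    Removing an edge e from a cycle C is an invertible column operation: the
    label of e is a combination of labels of exterior edges of C, whose columns
    vanish outside the row of C, so subtracting the combination of these
    columns from the column of e kills one entry and changes nothing else
    ([removal_free]).  The combination only needs columns of nonzero label, so
    the restriction to those columns is respected.

    When the decomposition is reached, distinct rows have disjoint supports,
    and the kernel is the direct sum of the kernels of single rows and of a
    coordinate space ([disjoint_rows_free]).  The entries of one row span a
    space of dimension at most 2 over k, so all of them are combinations, with
    constant coefficients, of at most two of them, and the other coordinates of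
    a relation can be chosen freely.  What is left is the module of syzygies of
    one or two polynomials a, b with a nonzero: it is 0 in the first case, and
    in the second case it is generated by (b/d, - a/d), where d is a greatest
    common divisor ([rank2_row_free]).

    So the arithmetic input is that k[x_1, ..., x_d] has greatest common
    divisors.  This is lifted from a domain A to A[X] with Gauss' lemma
    ([reducible_pairs_poly]) and then obtained by induction on the number of
    variables ([reducible_pairs_mpoly]).

    Part (a) is part (b) for the graph itself, with no removal at all. *)

Set Implicit Arguments.
Unset Strict Implicit.
Unset Printing Implicit Defensive.

Import GRing.Theory.
Local Open Scope ring_scope.

(** * Greatest common divisors in polynomial rings *)

Section Divisibility.
Variable R : idomainType.

Definition divides (u a : R) : Prop := exists c, a = c * u.

(** Coprimality, in the form in which it is used: it says at once that the
    syzygies of u and v are the multiples of (v, - u). *)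
Definition reduced (u v : R) : Prop := forall a, divides u (a * v) -> divides u a.

(** The existence of greatest common divisors, stated as the existence of
    fractions in lowest terms. *)
Definition reducible_pairs : Prop :=
  forall p q : R, p != 0 -> exists d u v, [/\ p = d * u, q = d * v & reduced u v].

Lemma dividesD u a b : divides u a -> divides u b -> divides u (a + b).
Proof. by case=> c -> [c' ->]; exists (c + c'); rewrite mulrDl. Qed.

Lemma dividesN u a : divides u a -> divides u (- a).
Proof. by case=> c ->; exists (- c); rewrite mulNr. Qed.

Lemma divides_sum (I : Type) (s : seq I) (P : pred I) (F : I -> R) u :
  (forall i, P i -> divides u (F i)) -> divides u (\sum_(i <- s | P i) F i).
Proof.
move=> uF; apply: big_ind => //; first by exists 0; rewrite mul0r.
exact: dividesD.
Qed.

(** Writing s u = x r and s v = y r, one gets x v = y u, so u divides x by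
    coprimality, and x / u is the quotient of s by r. *)
Lemma reduced_common u v s r :
  u != 0 -> reduced u v ->
  divides r (s * u) -> divides r (s * v) -> divides r s.
Proof.
move=> u0 uv [x su] [y sv].
have [r0|r0] := eqVneq r 0.
  exists 0; rewrite mul0r; apply/eqP; move/eqP: su.
  by rewrite r0 mulr0 mulf_eq0 (negPf u0) orbF.
have xv : x * v = y * u.
  apply: (mulIf r0); transitivity (s * u * v); first by rewrite su; ring.
  by rewrite mulrAC sv; ring.
have [z xE] : divides u x by apply: uv; exists y.
by exists z; apply: (mulIf u0); rewrite su xE; ring.
Qed.

End Divisibility.

Section Content.
Variable R : idomainType.
Implicit Types (f g h : {poly R}) (r s c : R).

Definition cdivides r f : Prop := exists g, f = r *: g.

(** Over a domain with greatest common divisors this says that the content of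
    f is 1; the definition by divisibility of multiples of f is the one that
    makes [gauss_lemma] hold over every domain. *)
Definition primitive f : Prop := forall r s, cdivides r (s *: f) -> divides r s.

Lemma cdividesP r f : cdivides r f <-> forall i, divides r f`_i.
Proof.
split=> [[g ->] i|rf]; first by exists g`_i; rewrite coefZ mulrC.
have [c fE] := choice rf.
exists (\poly_(i < size f) c i); apply/polyP => i.
rewrite coefZ coef_poly; case: ltnP => [_|fi]; first by rewrite fE mulrC.
by rewrite mulr0 nth_default.
Qed.

Lemma primitive1 : primitive 1.
Proof.
move=> r s /cdividesP /(_ 0%N).
by rewrite coefZ coef1 mulr1.
Qed.

Lemma primitive_neq0 f : primitive f -> f != 0.
Proof.
move=> fP; apply/eqP => f0.
have [|c] := fP 0 1; first by exists 0; rewrite f0 !scaler0.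
by rewrite mulr0 => /eqP; rewrite oner_eq0.
Qed.

Lemma primitive_dvd h d : primitive (h * d) -> primitive h.
Proof.
move=> hdP r s [g hE]; apply: hdP; exists (g * d).
by rewrite scalerAl hE scalerAl.
Qed.

(** This is McCoy's argument on zero divisors in (R / r)[X].  By descending
    induction on i, the coefficient f_i multiplies g into r R[X]: the
    coefficient of degree i + n of f g shows that r divides f_i g_n, so that
    the leading term can be removed from f_i g, and the induction on the size
    of g applies to what is left.  Then r divides g_j f for all j, and f is
    primitive. *)
Lemma gauss_lemma f r g : primitive f -> cdivides r (f * g) -> cdivides r g.
Proof.
move=> fP.
have [n] := ubnP (size g); elim: n g => [//|n IHn] g.
rewrite ltnS => gn rfg.
have [k fk] := ubnP (size f).
have fg i : cdivides r (f`_i *: g).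
  have [m] := ubnP (size f - i); elim: m i => [//|m IHm] i.
  rewrite ltnS => mi.
  have [fi|fi] := leqP (size f) i.
    by exists 0; rewrite nth_default // scale0r scaler0.
  case: n gn IHn => [|n] gn IHn.
    move: gn; rewrite leqn0 size_poly_eq0 => /eqP ->.
    by exists 0; rewrite !scaler0.
  have top : divides r (f`_i * g`_n).
    have := (cdividesP r (f * g)).1 rfg (i + n)%N.
    have lti : (i < (i + n).+1)%N by rewrite ltnS leq_addr.
    rewrite coefM (bigD1 (Ordinal lti)) //= addKn => rS.
    rewrite -[_ * _](addrK (\sum_(j < (i + n).+1 | j != Ordinal lti)
        f`_j * g`_(i + n - j))).
    apply: dividesD rS _; apply/dividesN/divides_sum => j ji.
    have [jlt|jge] := ltnP j i.
      exists 0; rewrite mul0r [g`__]nth_default ?mulr0 //.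
      apply: leq_trans gn _; rewrite -addnBAC; last exact: ltnW.
      by rewrite -addn1 addnC leq_add2r subn_gt0.
    have ltij : (i < j)%N.
      by rewrite ltn_neqAle jge andbT eq_sym; apply: contraNneq ji => ji; apply/eqP/val_inj.
    have := IHm j; rewrite -coefZ => /(_ _) H.
    apply: (cdividesP _ _).1; apply: H.
    by apply: leq_trans mi; rewrite ltn_sub2l.
  have fg'E : f`_i *: g = (f`_i *: g - (f`_i * g`_n) *: 'X^n) + (f`_i * g`_n) *: 'X^n.
    by rewrite subrK.
  rewrite fg'E; case: top => t tE.
  have [||h hE] := IHn (f`_i *: g - (f`_i * g`_n) *: 'X^n).
  - rewrite ltnS; apply/leq_sizeP => j nj; rewrite coefB !coefZ coefXn.
    have [->|jn] := eqVneq j n; first by rewrite mulr1 subrr.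
    by rewrite mulr0 subr0 [g`_j]nth_default ?mulr0 // (leq_trans gn) // ltn_neqAle eq_sym jn.
  - case: rfg => w wE; exists (f`_i *: w - t *: ('X^n * f)).
    rewrite mulrBr -!scalerAr wE tE scalerBr !scalerA.
    by rewrite [r * f`_i]mulrC [r * t]mulrC [f * _]mulrC.
  by exists (h + t *: 'X^n); rewrite hE tE scalerDr scalerA [r * t]mulrC.
apply/cdividesP => j; apply: fP; apply/cdividesP => i.
by rewrite coefZ mulrC -coefZ; apply: (cdividesP _ _).1.
Qed.

(** Horner induction: if f = c g with g primitive, then the content of f X + a
    is the greatest common divisor of c and a. *)
Lemma primitive_part : reducible_pairs R ->
  forall f, f != 0 -> exists c g, f = c *: g /\ primitive g.
Proof.
move=> redR f; elim/poly_ind: f => [|f a IHf]; first by rewrite eqxx.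
move=> f0; have [fz|fz] := eqVneq f 0.
  exists a, 1; rewrite fz mul0r add0r alg_polyC; split=> //; exact: primitive1.
have {IHf} [c [g [fE gP]]] := IHf fz.
have c0 : c != 0 by apply: contraNneq fz => c0; rewrite fE c0 scale0r.
have [d [u [v [cE aE uv]]]] := redR c a c0.
have u0 : u != 0 by apply: contraNneq c0 => u0; rewrite cE u0 mulr0.
exists d, (u *: (g * 'X) + v%:P); split.
  rewrite fE scalerDr scalerA -cE scalerAl; congr (_ + _).
  by rewrite -mul_polyC -polyCM aE.
move=> r s /cdividesP rs; apply: (reduced_common u0 uv).
  apply: gP; apply/cdividesP => i.
  by have := rs i.+1; rewrite -scalerA !coefZ coefD coefC addr0 coefZ coefMX.
have := rs 0%N.
by rewrite coefZ coefD coefC /= coefZ coefMX /= mulr0 add0r.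
Qed.

Lemma scalep_inj c f g : c != 0 -> c *: f = c *: g -> f = g.
Proof.
by rewrite -polyC_eq0 -!mul_polyC => c0 /(mulfI c0).
Qed.

Lemma primitive_dvdp d f : primitive d -> d %| f -> exists h, f = h * d.
Proof.
move=> dP /Pdiv.WeakIdomain.dvdpP [[k q] /= k0 kf].
have [h qE] : cdivides k q.
  by apply: (gauss_lemma dP); exists f; rewrite mulrC kf.
exists h; apply: (scalep_inj k0); rewrite kf qE scalerAl //.
Qed.

(** Split p and q into contents and primitive parts.  The contents are
    reduced in R.  The primitive parts are reduced by the primitive part k of
    a greatest common divisor over the fraction field, which pseudo-division
    provides without leaving R[X]; Gauss' lemma turns divisibility up to a
    constant by a primitive polynomial into divisibility. *)
Lemma reducible_pairs_poly : reducible_pairs R -> reducible_pairs {poly R}.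
Proof.
move=> redR p q p0; have [->|q0] := eqVneq q 0.
  exists p, 1, 0; rewrite mulr1 mulr0; split=> // a _.
  by exists a; rewrite mulr1.
have [c [f [pE fP]]] := primitive_part redR p0.
have [c' [g [qE gP]]] := primitive_part redR q0.
have c0 : c != 0 by apply: contraNneq p0 => c0; rewrite pE c0 scale0r.
have c'0 : c' != 0 by apply: contraNneq q0 => c'0; rewrite qE c'0 scale0r.
have [d [u [v [cE c'E uv]]]] := redR c c' c0.
have u0 : u != 0 by apply: contraNneq c0 => u0; rewrite cE u0 mulr0.
have v0 : v != 0 by apply: contraNneq c'0 => v0; rewrite c'E v0 mulr0.
have gcd0 : gcdp f g != 0 by rewrite gcdp_eq0 (negPf (primitive_neq0 fP)).
have [e [k [gcdE kP]]] := primitive_part redR gcd0.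
have e0 : e != 0 by apply: contraNneq gcd0 => e0; rewrite gcdE e0 scale0r.
have kgcd : k %| gcdp f g by rewrite gcdE dvdpZr.
have [f' fE] := primitive_dvdp kP (dvdp_trans kgcd (dvdp_gcdl f g)).
have [g' gE] := primitive_dvdp kP (dvdp_trans kgcd (dvdp_gcdr f g)).
have f'P : primitive f' by apply: (@primitive_dvd _ k); rewrite -fE.
have g'P : primitive g' by apply: (@primitive_dvd _ k); rewrite -gE.
have k0 : k != 0 by apply: primitive_neq0.
have cop : coprimep f' g'.
  rewrite coprimep_def.
  have : gcdp f g %= gcdp f' g' * k by rewrite fE gE gcdp_mul2r.
  have : gcdp f g %= k by rewrite gcdE eqp_scale.
  rewrite eqp_sym => /eqp_trans H /H.
  rewrite -{1}[k]mul1r eqp_mul2r // eqp_sym => /eqp_size ->.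
  by rewrite size_poly1.
exists (d *: k), (u *: f'), (v *: g'); split.
- by rewrite -scalerAl -scalerAr scalerA -cE [k * _]mulrC -fE.
- by rewrite -scalerAl -scalerAr scalerA -c'E [k * _]mulrC -gE.
move=> a [w aw].
have ua : cdivides u a.
  apply/cdividesP => i; apply: uv.
  have /cdividesP /(_ i): cdivides u (v *: a).
    apply: (gauss_lemma g'P); exists (w * f').
    by rewrite -scalerAr [g' * a]mulrC scalerAr aw scalerAr.
  by rewrite coefZ mulrC.
case: ua aw => b -> aw.
have f'b : f' %| b.
  rewrite -(Gauss_dvdpl _ cop); apply/Pdiv.WeakIdomain.dvdpP; exists (v, w) => //=.
  by apply: (scalep_inj u0); rewrite [RHS]scalerAr -aw -scalerAl -scalerAr.
have [t bE] := primitive_dvdp f'P f'b.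
by exists t; rewrite bE scalerAr.
Qed.

End Content.

Section MPoly.
Variable k : fieldType.

Lemma muniX n (m : 'X_{1..n.+1}) :
  muni 'X_[m] = 'X_[[multinom m (widen_ord (leqnSn n) i) | i < n]] *: 'X^(m ord_max)
  :> {poly {mpoly k[n]}}.
Proof. by rewrite muniE msuppX big_seq1 mcoeffX eqxx scale1r. Qed.

(** The inverse of [muni]: a polynomial in one variable over k[x_1, ..., x_n]
    evaluated at the last variable. *)
Definition mevalmax n : {poly {mpoly k[n]}} -> {mpoly k[n.+1]} :=
  horner_eval 'X_ord_max \o map_poly (@mwiden n k).

HB.instance Definition _ n := GRing.RMorphism.copy (@mevalmax n)
  (horner_eval 'X_ord_max \o map_poly (@mwiden n k)).

Lemma mevalmaxC n c : @mevalmax n c%:P = mwiden c.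
Proof. by rewrite /mevalmax /= map_polyC /= /horner_eval hornerC. Qed.

Lemma mevalmaxX n : @mevalmax n 'X = 'X_ord_max.
Proof. by rewrite /mevalmax /= map_polyX /horner_eval hornerX. Qed.

Lemma muniK n : cancel (@muni n k) (@mevalmax n).
Proof.
move=> p; elim/mpolyind: p => [|c m p _ _ IHp]; first by rewrite !rmorph0.
rewrite muniD muniZ rmorphD [X in _ + X]IHp; congr (_ + _).
rewrite muniX -mul_polyC -mul_polyC !rmorphM rmorphXn /= !mevalmaxC mevalmaxX.
rewrite mwidenC mwidenX mpolyXn -mpolyXD mul_mpolyC; congr (_ *: 'X_[_]).
apply/mnmP => i; rewrite mnmDE mulmnE mnm1E.
have [j ->|->] := unliftP ord_max i.
  rewrite (negPf (neq_lift _ _)) mul0n addn0.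
  have -> : lift ord_max j = widen_ord (leqnSn n) j.
    by apply/val_inj; rewrite /= /bump leqNgt ltn_ord.
  by rewrite mnmwiden_widen mnmE.
by rewrite mnmwiden_ordmax eqxx mul1n.
Qed.

Lemma muni_mwiden n (c : {mpoly k[n]}) : muni (mwiden c) = c%:P.
Proof.
elim/mpolyind: c => [|a m c _ _ IHc]; first by rewrite mwiden0 muni0.
rewrite mwidenD muniD IHc mwidenZ muniZ polyCD; congr (_ + _).
rewrite mwidenX muniX mnmwiden_ordmax expr0 alg_polyC -mul_polyC -polyCM.
rewrite -mul_mpolyC; congr (_ * 'X_[_])%:P.
by apply/mnmP => i; rewrite mnmE mnmwiden_widen.
Qed.

Lemma mevalmaxK n : cancel (@mevalmax n) (@muni n k).
Proof.
move=> p; elim/poly_ind: p => [|p c IHp]; first by rewrite rmorph0 muni0.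
rewrite rmorphD rmorphM /= mevalmaxC mevalmaxX muniD muniM IHp muni_mwiden.
congr (_ * _ + _); rewrite muniX mnm1E eqxx expr1.
rewrite (_ : [multinom _ | i < n] = 0%MM) ?mpolyX0 ?scale1r //.
apply/mnmP => i; rewrite mnmE mnm1E mnm0E.
by rewrite -val_eqE /= gtn_eqF.
Qed.

Lemma reducible_pairs_mpoly n : reducible_pairs {mpoly k[n]}.
Proof.
elim: n => [|n /reducible_pairs_poly redP].
  move=> p q; rewrite [p]nvar0_mpolyC mpolyC_eq0 => p0.
  set c := p@_0%MM in p0 *.
  exists c%:MP, 1, ((c^-1)%:MP * q); split.
  - by rewrite mulr1.
  - by rewrite mulrA -mpolyCM divff // mul1r.
  - by move=> a _; exists a; rewrite mulr1.
move=> p q p0.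
have mp0 : muni p != 0 by rewrite -(inj_eq (can_inj (@muniK n))) muni0 in p0.
have [d [u [v [pE qE uv]]]] := redP (muni p) (muni q) mp0.
exists (mevalmax d), (mevalmax u), (mevalmax v); split.
- by rewrite -[LHS]muniK pE rmorphM.
- by rewrite -[LHS]muniK qE rmorphM.
move=> a [c ac]; have [|t at_] := uv (muni a).
  exists (muni c); have /(congr1 (@muni n k)) := ac.
  by rewrite !muniM !mevalmaxK.
by exists (mevalmax t); rewrite -[LHS]muniK at_ rmorphM.
Qed.

End MPoly.

(** * Free modules of finite rank *)

Section FiniteFree.
Variable R : comNzRingType.

(** Submodules are given by predicates on an ambient module, so that no type
    has to be built for each kernel and image below. *)
Definition finite_free (V : lmodType R) (P : V -> Prop) : Prop :=
  exists (I : finType) (b : I -> V),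
    (forall x, P x <-> exists c : I -> R, x = \sum_i c i *: b i) /\
    (forall c : I -> R, \sum_i c i *: b i = 0 -> forall i, c i = 0).

Lemma finite_free_iff (V : lmodType R) (P Q : V -> Prop) :
  (forall x, P x <-> Q x) -> finite_free P -> finite_free Q.
Proof.
move=> PQ [I [b [bP bI]]]; exists I, b; split=> // x.
by split=> [/PQ /bP|/bP /PQ].
Qed.

Lemma finite_free_zero (V : lmodType R) (P : V -> Prop) :
  (forall x, P x <-> x = 0) -> finite_free P.
Proof.
move=> P0; exists void, (fun _ => 0); split=> [x|c _ []].
split=> [/P0 ->|[c ->]]; first by exists (fun _ => 0); rewrite big1 // => -[].
by rewrite big1 => [|[]]; apply/P0.
Qed.

Lemma finite_free_image (V V' : lmodType R) (T : {linear V -> V'})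
    (P : V -> Prop) (Q : V' -> Prop) :
  (forall x, P x -> T x = 0 -> x = 0) ->
  (forall y, Q y <-> exists2 x, P x & y = T x) ->
  finite_free P -> finite_free Q.
Proof.
move=> Tinj QT [I [b [bP bI]]]; exists I, (fun i => T (b i)).
have TS (c : I -> R) : T (\sum_i c i *: b i) = \sum_i c i *: T (b i).
  by rewrite linear_sum; apply: eq_bigr => i _; rewrite linearZ.
split=> [y|c]; last first.
  by rewrite -TS => /Tinj H; apply/bI/H/bP; exists c.
split=> [/QT[x /bP[c ->] ->]|[c ->]]; first by exists c.
by apply/QT; exists (\sum_i c i *: b i) => //; apply/bP; exists c.
Qed.

(** A sequence 0 -> ker T -> W -> Q -> 0 with Q free splits: a basis of W
    consists of a basis of the kernel and of lifts of a basis of Q. *)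
Lemma finite_free_extension (V V' : lmodType R) (T : {linear V -> V'})
    (W : V -> Prop) (Q : V' -> Prop) :
  (forall a x y, W x -> W y -> W (a *: x + y)) ->
  (forall x, W x -> Q (T x)) ->
  (forall y, Q y -> exists2 x, W x & T x = y) ->
  finite_free (fun x => W x /\ T x = 0) -> finite_free Q -> finite_free W.
Proof.
move=> Wlin WQ QW [I [b [bP bI]]] [J [e [eP eI]]].
have /choice[f fP] : forall j, exists x, W x /\ T x = e j.
  move=> j; have [|x Wx Tx] := QW (e j); last by exists x.
  apply/eP; exists (fun j' => (j' == j)%:R).
  rewrite (bigD1 j) //= eqxx scale1r big1 ?addr0 // => i /negPf ->.
  by rewrite scale0r.
have W0 : W 0 by have /bP[] : exists c : I -> R, 0 = \sum_i c i *: b i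
   by exists (fun _ => 0); rewrite big1 // => i _; rewrite scale0r.
have WS (c : J -> R) : W (\sum_j c j *: f j).
  apply: (big_ind W) => // [x y Wx Wy|j _].
    by rewrite -[x]scale1r; apply: Wlin.
  by rewrite -[_ *: _]addr0; apply: Wlin => //; case: (fP j).
have TS (c : J -> R) : T (\sum_j c j *: f j) = \sum_j c j *: e j.
  by rewrite linear_sum; apply: eq_bigr => j _; rewrite linearZ /= (fP j).2.
exists (I + J)%type, (fun i => match i with inl i => b i | inr j => f j end).
split=> [x|c]; last first.
  rewrite big_sumType /= => S0.
  have cJ j : c (inr j) = 0.
    move: j; apply: eI; rewrite -TS; have := congr1 T S0.
    rewrite linearD /= linear0 => <-.
    have /bP[_ ->] : exists c' : I -> R,
        \sum_i c (inl i) *: b i = \sum_i c' i *: b i by exists (fun i => c (inl i)).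
    by rewrite add0r.
  case=> [i|//]; move: i; apply: bI.
  by rewrite [X in _ + X]big1 ?addr0 // in S0 => j _; rewrite cJ scale0r.
split=> [Wx|[c ->]]; last first.
  rewrite big_sumType /= -[X in X + _]scale1r; apply: Wlin (WS _).
  by apply: proj1 ((bP _).2 _); exists (fun i => c (inl i)).
have [c cE] := (eP _).1 (WQ _ Wx).
have [c' c'E] : exists c' : I -> R, - (\sum_j c j *: f j) + x = \sum_i c' i *: b i.
  apply/bP; split; first by rewrite -scaleN1r; apply: Wlin.
  by rewrite linearD linearN /= TS cE addNr.
exists (fun i => match i with inl i => c' i | inr j => c j end).
by rewrite big_sumType /= -c'E addrC addrA subrr add0r.
Qed.

Lemma finite_free_supported (J : finType) (S : {set J}) :
  finite_free (fun g : {ffun J -> R^o} => forall j, j \notin S -> g j = 0).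
Proof.
have sumE (c : {j | j \in S} -> R) j :
    (\sum_i c i *: ([ffun x => (x == val i)%:R] : {ffun J -> R^o})) j
    = if insub j is Some i then c i else 0.
  rewrite sum_ffunE; case: insubP => [i jS iE|jS]; last first.
    rewrite big1 // => i _; rewrite !ffunE.
    have [jE|_] := eqVneq j (val i); last by rewrite scaler0.
    by rewrite jE (valP i) in jS.
  rewrite (bigD1 i) //= !ffunE iE eqxx big1 ?addr0 => [|i' ii'].
    by rewrite [_ *: _]mulr1.
  by rewrite !ffunE -iE (inj_eq val_inj) eq_sym (negPf ii') scaler0.
exists {j | j \in S}, (fun i => [ffun x => (x == val i)%:R]); split=> [g|c S0 i].
  split=> [g0|[c ->] j jS]; last by rewrite sumE insubN.
  exists (fun i => g (val i)); apply/ffunP => j; rewrite sumE.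
  by case: insubP => [i _ ->|/g0].
by have := sumE c (val i); rewrite S0 ffunE valK.
Qed.

End FiniteFree.

(** * Relations between the columns of a matrix *)

Section Relations.
Variables (R : comNzRingType) (J : finType).
Implicit Types (S X : {set J}) (g : {ffun J -> R^o}) (a : J -> R).

Definition proj_on S g : {ffun J -> R^o} := [ffun j => if j \in S then g j else 0].

Lemma proj_on_is_linear S : linear (proj_on S).
Proof.
move=> c g h; apply/ffunP => j; rewrite !ffunE.
by case: ifP => // _; rewrite scaler0 addr0.
Qed.

HB.instance Definition _ S :=
  GRing.isLinear.Build R _ _ _ (proj_on S) (proj_on_is_linear S).

Definition supported S g : Prop := forall j, j \notin S -> g j = 0.

Lemma proj_on_eq0 S g : proj_on S g = 0 <-> forall j, j \in S -> g j = 0.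
Proof.
split=> [/ffunP m0 j jS|g0]; first by have := m0 j; rewrite !ffunE jS.
by apply/ffunP => j; rewrite !ffunE; case: ifP => // /g0.
Qed.

Lemma proj_on_supported S g : supported S g -> proj_on S g = g.
Proof.
move=> g0; apply/ffunP => j; rewrite ffunE.
by case: ifPn => // /g0 ->.
Qed.

Definition row_relations a S g : Prop :=
  supported S g /\ \sum_j a j * g j = 0.

Lemma row_relations_lin a S c g h : row_relations a S g ->
  row_relations a S h -> row_relations a S (c *: g + h).
Proof.
move=> [gS ga] [hS ha]; split=> [j jS|].
  by rewrite !ffunE gS // hS // scaler0 addr0.
under eq_bigr => j _ do rewrite !ffunE mulrDr mulrCA.
by rewrite big_split /= -mulr_sumr ga ha mulr0 addr0.
Qed.

(** The coordinates outside X can be prescribed at will, since the columns of X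
    compensate for them; the projection to them makes the relations on S an
    extension of a coordinate space by the relations on X. *)
Lemma row_relations_generated a S X : X \subset S ->
  (forall j, j \in S -> exists c : J -> R, a j = \sum_(x in X) c x * a x) ->
  finite_free (row_relations a X) -> finite_free (row_relations a S).
Proof.
move=> XS gen freeX.
have /choice[c cE] : forall j, exists c : J -> R, j \in S ->
    a j = \sum_(x in X) c x * a x.
  move=> j; have [/gen[c ->]|_] := boolP (j \in S); first by exists c.
  by exists (fun _ => 0).
apply: (@finite_free_extension _ _ _ (proj_on (S :\: X)) _ (supported (S :\: X))).
- by move=> *; apply: row_relations_lin.
- by move=> g _ j /negPf jSX; rewrite ffunE jSX.
- move=> g gSX.
  (* the correction by [c j] on X cancels the contribution of column j *)
  pose h := g - \sum_j g j *: ([ffun x => if x \in X then c j x else 0] : {ffun J -> R^o}).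
  have hE x : h x = g x - if x \in X then \sum_j g j * c j x else 0.
    rewrite /h !ffunE sum_ffunE; congr (_ - _).
    case: ifP => xX; first by apply: eq_bigr => j _; rewrite !ffunE xX.
    by rewrite big1 // => j _; rewrite !ffunE xX scaler0.
  exists h; last first.
    apply/ffunP => j; rewrite ffunE hE inE; case: (boolP (j \in X)) => jX /=.
      by rewrite gSX // inE jX.
    by rewrite subr0; case: ifPn => // jS; rewrite gSX // inE negb_and jS orbT.
  split=> [j jS|].
    have jX : j \notin X by apply: contra jS; apply: (subsetP XS).
    by rewrite hE (negPf jX) subr0 gSX // inE negb_and jS orbT.
  under eq_bigr => j _ do rewrite hE mulrBr.
  rewrite sumrB; apply/eqP; rewrite subr_eq0; apply/eqP.
  transitivity (\sum_j \sum_(x in X) g j * (c j x * a x)).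
    apply: eq_bigr => j _; rewrite -mulr_sumr mulrC.
    have [jS|jS] := boolP (j \in S); first by rewrite -cE.
    by rewrite gSX ?mul0r // inE negb_and jS orbT.
  rewrite exchange_big /= big_mkcond /=; apply: eq_bigr => x _.
  case: ifP => _; last by rewrite mulr0.
  by rewrite mulr_sumr; apply: eq_bigr => j _; rewrite mulrA mulrC.
- apply: finite_free_iff freeX => g; split=> [[gX ga]|[[gS ga] /proj_on_eq0 gSX]].
    split; first by split=> // j jS; apply: gX; apply: contra jS; apply: (subsetP XS).
    by apply/proj_on_eq0 => j; rewrite inE => /andP[/gX].
  split=> // j jX; have [jS|/gS //] := boolP (j \in S).
  by apply: gSX; rewrite inE jX.
exact: finite_free_supported.
Qed.

Variable I : eqType.
Implicit Types (A : I -> J -> R) (r : seq I).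

Definition relations A r S g : Prop :=
  supported S g /\ forall i, i \in r -> \sum_j A i j * g j = 0.

Lemma relations_lin A r S c g h : relations A r S g ->
  relations A r S h -> relations A r S (c *: g + h).
Proof.
move=> [gS gA] [hS hA]; split=> [j jS|i ir].
  by rewrite !ffunE gS // hS // scaler0 addr0.
exact: (row_relations_lin c (conj gS (gA i ir)) (conj hS (hA i ir))).2.
Qed.

(** Induction on the rows: projecting to the support T of the first row splits
    off the relations of that row, and the remaining rows do not see T. *)
Lemma disjoint_rows_free A r S :
  uniq r -> (forall i i' j, i != i' -> A i j = 0 \/ A i' j = 0) ->
  (forall i S', finite_free (row_relations (A i) S')) ->
  finite_free (relations A r S).
Proof.
move=> + disjA freeA; elim: r S => [|i r IHr] S /=.
  move=> _; apply: finite_free_iff (finite_free_supported R S) => g.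
  by split=> // -[].
case/andP=> ir /IHr {}IHr; pose T := [set j in S | A i j != 0].
have rowT g : supported S g -> \sum_j A i j * proj_on T g j = \sum_j A i j * g j.
  move=> gS; apply: eq_bigr => j _; rewrite ffunE inE.
  have [jS|/gS ->] := boolP (j \in S); last by rewrite mulr0.
  by have [->|] := eqVneq (A i j) 0; rewrite ?mul0r.
apply: (@finite_free_extension _ _ _ (proj_on T) _ (row_relations (A i) T)).
- by move=> *; apply: relations_lin.
- move=> g [gS gA]; split=> [j /negPf jT|]; first by rewrite ffunE jT.
  by rewrite rowT // gA // mem_head.
- move=> g [gT gA]; exists g; last exact: proj_on_supported.
  split=> [j jS|i']; first by apply: gT; rewrite inE (negPf jS).
  rewrite inE => /predU1P[-> //|i'r]; apply: big1 => j _.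
  have [/[!inE] /andP[jS Aij]|/gT ->] := boolP (j \in T); last exact: mulr0.
  have ii' : i != i' by apply: contraNneq ir => ->.
  by case: (disjA i i' j ii') Aij => [->|->]; rewrite ?eqxx ?mul0r.
- apply: finite_free_iff (IHr (S :\: T)) => g; split.
    move=> [gST gA]; have gS : supported S g.
      by move=> j jS; apply: gST; rewrite inE negb_and jS orbT.
    have gT : proj_on T g = 0.
      by apply/proj_on_eq0 => j jT; apply: gST; rewrite inE jT.
    split=> //; split=> // i'; rewrite inE => /predU1P[->|/gA //].
    by rewrite -rowT // gT big1 // => j _; rewrite ffunE mulr0.
  move=> [[gS gA] /proj_on_eq0 gT]; split=> [j|i' i'r]; last first.
    by apply: gA; rewrite inE i'r orbT.
  by rewrite inE negb_and negbK => /orP[/gT|/gS].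
exact: freeA.
Qed.

(** [A'] is the product of [A] with the unipotent matrix that subtracts the
    combination [d] of columns from the column [e]; as [d e = 0], the inverse
    adds it back.  The support of [d] lies in S, so both matrices preserve the
    vectors supported on S. *)
Lemma column_operation_free A A' r S (e : J) (d : J -> R) :
  d e = 0 -> (forall j, j \notin S -> d j = 0) ->
  (forall i j, i \in r ->
     A' i j = A i j - (j == e)%:R * \sum_x A i x * d x) ->
  finite_free (relations A' r S) -> finite_free (relations A r S).
Proof.
move=> de dS AA'.
pose T g : {ffun J -> R^o} := [ffun j => g j - d j * g e].
have Tlin : linear T.
  move=> c g h; apply/ffunP => j; rewrite !ffunE mulrDr opprD addrACA.
  by rewrite scalerBr [d j * _]mulrCA.
pose TL := GRing.isLinear.Build R _ _ _ T Tlin.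
pose T' : {linear {ffun J -> R^o} -> {ffun J -> R^o}} := HB.pack T TL.
have TA g i : i \in r -> \sum_j A' i j * g j = \sum_j A i j * T g j.
  move=> ir; under eq_bigr => j _ do rewrite AA' // mulrBl.
  under [RHS]eq_bigr => j _ do rewrite ffunE mulrBr mulrA.
  rewrite !sumrB; congr (_ - _); rewrite -mulr_suml.
  move: (\sum_x A i x * d x) => s.
  rewrite (bigD1 e) //= eqxx mul1r big1 ?addr0 // => j /negPf ->.
  by rewrite !mul0r.
apply: (@finite_free_image _ _ _ T').
  move=> g _ /ffunP T0.
  have ge : g e = 0 by have := T0 e; rewrite !ffunE de mul0r subr0.
  by apply/ffunP => j; have := T0 j; rewrite !ffunE ge mulr0 subr0.
move=> h; split=> [[hS hA]|[g [gS gA] ->]].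
  pose g : {ffun J -> R^o} := [ffun j => h j + d j * h e].
  have Tg : T g = h.
    by apply/ffunP => j; rewrite !ffunE de mul0r addr0 addrK.
  exists g; last by rewrite -Tg.
  split=> [j jS|i ir]; first by rewrite ffunE hS // dS // mul0r addr0.
  by rewrite TA // Tg hA.
split=> [j jS|i ir]; first by rewrite ffunE gS // dS // mul0r subr0.
by rewrite -[LHS]TA // gA.
Qed.

End Relations.

(** * A row of rank at most two *)

Section RankTwo.
Variables (R : idomainType) (J : finType).
Hypothesis redR : reducible_pairs R.
Implicit Types (S : {set J}) (g : {ffun J -> R^o}) (a : J -> R).

(** The generator is the Koszul relation between [a j0] and [a j1] divided by
    their greatest common divisor. *)
Lemma pair_relations_free a (j0 j1 : J) : j0 != j1 -> a j0 != 0 ->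
  finite_free (row_relations a [set j0; j1]).
Proof.
move=> j01 a0; have [d [u [v [ua va uv]]]] := redR (a j1) a0.
have d0 : d != 0 by apply: contraNneq a0 => d0; rewrite ua d0 mul0r.
have u0 : u != 0 by apply: contraNneq a0 => u0; rewrite ua u0 mulr0.
pose w : {ffun J -> R^o} := [ffun j => v * (j == j0)%:R - u * (j == j1)%:R].
have w0 : w j0 = v by rewrite ffunE eqxx (negPf j01) mulr0 mulr1 subr0.
have w1 : w j1 = - u.
  by rewrite ffunE eqxx eq_sym (negPf j01) mulr0 mulr1 sub0r.
have row2 g : supported [set j0; j1] g ->
    \sum_j a j * g j = d * (u * g j0 + v * g j1).
  move=> g2; rewrite (bigD1 j0) //= (bigD1 j1) 1?eq_sym //= big1 => [|j].
    by rewrite ua va addr0 mulrDr !mulrA.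
  by move=> /andP[jj0 jj1]; rewrite g2 ?mulr0 // !inE negb_or jj0.
exists 'I_1, (fun _ => w); split=> [g|c].
  split=> [[g2 ga]|[c ->]].
    have ugv : u * g j0 + v * g j1 = 0.
      by apply/eqP; have /eqP := ga; rewrite row2 // mulf_eq0 (negPf d0).
    have [|t tE] := uv (g j1).
      exists (- g j0); rewrite mulNr; apply/eqP.
      by rewrite -addr_eq0 addrC [_ * u]mulrC [_ * v]mulrC ugv.
    exists (fun _ => - t); rewrite big_ord1.
    apply/ffunP => j; rewrite [RHS]ffunE.
    have [->|jj0] := eqVneq j j0.
      rewrite w0 /GRing.scale /=; apply: (mulfI u0).
      by rewrite [u * g j0](canRL (addrK _) ugv) tE; ring.
    have [->|jj1] := eqVneq j j1.
      by rewrite w1 tE /GRing.scale /= mulrNN.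
    rewrite g2 ?inE ?negb_or ?jj0 //.
    by rewrite ffunE (negPf jj0) (negPf jj1) !mulr0 subr0 scaler0.
  rewrite big_ord1; have cw : supported [set j0; j1] (c ord0 *: w).
    move=> j; rewrite !inE negb_or => /andP[/negPf jj0 /negPf jj1].
    by rewrite !ffunE jj0 jj1 !mulr0 subr0 scaler0.
  split=> //; rewrite row2 // [X in u * X]ffunE [X in v * X]ffunE w0 w1.
  by rewrite /GRing.scale /=; ring.
rewrite big_ord1 => /ffunP /(_ j1); rewrite !ffunE => cw0 i; rewrite ord1.
move: cw0; rewrite eqxx eq_sym (negPf j01) mulr0 mulr1 sub0r.
by move=> /eqP; rewrite [_ *: _]mulrN oppr_eq0 mulf_eq0 (negPf u0) orbF => /eqP.
Qed.

(** The pairs [c j] of coordinates of [a j] on p and q are vectors of the plane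
    over k.  If [a j0] is nonzero, either some [c j1] is independent of [c j0],
    and [a j0], [a j1] generate all entries, or [a j0] alone does.  As p
    and q may be linearly dependent, a nonzero vector [c j0] can belong to a
    zero entry, so the case distinction starts from the entry. *)
Lemma rank2_row_free (k : fieldType) (phi : {rmorphism k -> R}) a S p q :
  (forall j, j \in S -> exists x y, a j = phi x * p + phi y * q) ->
  finite_free (row_relations a S).
Proof.
move=> aS.
have /choice[c cE] : forall j, exists c : k * k,
    j \in S -> a j = phi c.1 * p + phi c.2 * q.
  move=> j; have [/aS[x [y ->]]|_] := boolP (j \in S); first by exists (x, y).
  by exists (0, 0).
have [/forall_inP a0|] := boolP [forall (j | j \in S), a j == 0].
  apply: (@row_relations_generated _ _ _ _ set0 (sub0set _)).
    by move=> j /a0/eqP ->; exists a; rewrite big_set0.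
  apply: finite_free_zero => g; split=> [[g0 _]|->].
    by apply/ffunP => j; rewrite g0 ?inE // ffunE.
  by split=> [j _|]; rewrite ?ffunE // big1 // => j _; rewrite ffunE mulr0.
rewrite negb_forall_in => /exists_inP[j0 j0S a0].
have [/exists_inP[j1 j1S]|] :=
    boolP [exists (j1 | j1 \in S), (c j0).1 * (c j1).2 - (c j1).1 * (c j0).2 != 0].
  set D := _ - _ => D0.
  have j01 : j0 != j1 by apply: contraNneq D0 => j01; rewrite /D j01 subrr.
  apply: (@row_relations_generated _ _ _ _ [set j0; j1]).
  - by apply/subsetP => j; rewrite !inE => /orP[]/eqP->.
  - move=> j jS.
    pose x := ((c j).1 * (c j1).2 - (c j1).1 * (c j).2) / D.
    pose y := ((c j0).1 * (c j).2 - (c j).1 * (c j0).2) / D.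
    exists (fun i => phi (if i == j0 then x else y)).
    rewrite big_setU1 ?inE //= big_set1 eqxx eq_sym (negPf j01) !cE //.
    have E1 : (c j).1 = x * (c j0).1 + y * (c j1).1.
      by rewrite /x /y /D; field; exact: D0.
    have E2 : (c j).2 = x * (c j0).2 + y * (c j1).2.
      by rewrite /x /y /D; field; exact: D0.
    by rewrite {1}E1 {1}E2 !rmorphD !rmorphM /=; ring.
  exact: pair_relations_free.
rewrite negb_exists_in => /forall_inP minor0.
apply: (@row_relations_generated _ _ _ _ [set j0]).
- by rewrite sub1set.
- move=> j jS; have /negPn/eqP/subr0_eq jj0 := minor0 j jS.
  suff [t t1 t2] : exists2 t, (c j).1 = t * (c j0).1 & (c j).2 = t * (c j0).2.
    exists (fun _ => phi t); rewrite big_set1 !cE // t1 t2 !rmorphM /=; ring.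
  have [x0|x0] := eqVneq (c j0).1 0; last first.
    exists ((c j).1 / (c j0).1); first by rewrite divfK.
    by rewrite mulrAC -jj0 [X in X / _]mulrC mulfK.
  have y0 : (c j0).2 != 0.
    by apply: contraNneq a0 => y0; rewrite cE // x0 y0 !rmorph0 !mul0r addr0.
  exists ((c j).2 / (c j0).2); last by rewrite divfK.
  move/eqP: jj0; rewrite x0 mul0r mulr0 eq_sym mulf_eq0 (negPf y0) orbF.
  by move/eqP.
apply: finite_free_zero => g; split=> [[g0 ga]|->]; last first.
  by split=> [j _|]; rewrite ?ffunE // big1 // => j _; rewrite ffunE mulr0.
have gj j : j != j0 -> g j = 0 by move=> jj0; apply: g0; rewrite inE.
apply/ffunP => j; rewrite [RHS]ffunE; have [->|/gj //] := eqVneq j j0.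
move: ga; rewrite (bigD1 j0) //= big1 => [|i /gj ->]; last exact: mulr0.
by move=> /eqP; rewrite addr0 mulf_eq0 (negPf a0) => /eqP.
Qed.

End RankTwo.

(** * Cycles in simple graphs *)

Section Walks.
Variables (R : comNzRingType) (G : lgraph R).
Local Notation V := (vertex G).
Local Notation E := (edge G).
Local Notation dsrc := (@Defs.dsrc R G).
Local Notation dtgt := (@Defs.dtgt R G).
Implicit Types (t s : seq (dart G)) (x y z : dart G) (C D S : {set E}).

Fixpoint dpath (u : V) t (v : V) : bool :=
  if t is x :: t' then (dsrc x == u) && dpath (dtgt x) t' v else u == v.

Lemma dpath_cat u t s w : dpath u (t ++ s) w ->
  exists2 v, dpath u t v & dpath v s w.
Proof.
elim: t u => [|x t IHt] u /=; first by exists u.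
by case/andP=> -> /IHt[v tv sw]; exists v.
Qed.

Lemma dpath_rcons u t x : dpath u t (dsrc x) -> dpath u (rcons t x) (dtgt x).
Proof.
elim: t u => [|y t IHt] u /=; first by rewrite eq_sym eqxx andbT.
by case/andP=> -> /IHt.
Qed.

Lemma dpath_srcs u t v : dpath u t v -> rcons (map dsrc t) v = u :: map dtgt t.
Proof.
elim: t u => [|x t IHt] u /=; first by move/eqP->.
by case/andP=> /eqP-> /IHt ->.
Qed.

Lemma path_dpath x t y :
  path (fun x y => dtgt x == dsrc y) x (rcons t y) = dpath (dtgt x) t (dsrc y).
Proof. by elim: t x => [|z t IHt] x /=; rewrite ?andbT // IHt eq_sym. Qed.

Lemma traverses_dpath t C : traverses t C -> exists u, dpath u t u.
Proof.
case/and5P; case: t => [//|x t _ /=].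
by rewrite path_dpath => xt _ _ _; exists (dsrc x); rewrite eqxx.
Qed.

Lemma dpath_traverses u t : t != [::] -> dpath u t u ->
  uniq (map dsrc t) -> uniq (map fst t) -> traverses t [set e in map fst t].
Proof.
move=> t0 tu us ut; apply/and5P; split=> //; case: t t0 tu {us ut} => //= x t _.
by case/andP=> /eqP <-; rewrite path_dpath.
Qed.

Lemma traverses_mem t C e : traverses t C -> (e \in C) = (e \in map fst t).
Proof. by case/and5P=> _ _ _ _ /eqP->; rewrite inE. Qed.

Lemma traverses_dart t C e : traverses t C -> e \in C -> exists2 x, x \in t & x.1 = e.
Proof.
by move=> tC; rewrite (traverses_mem _ tC) => /mapP[x xt ->]; exists x.
Qed.

Lemma traverses_edge t C x : traverses t C -> x \in t -> x.1 \in C.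
Proof. by move=> tC xt; rewrite (traverses_mem _ tC) map_f. Qed.

Lemma uniq_map_inj (T T' : eqType) (f : T -> T') (r : seq T) :
  uniq (map f r) -> {in r &, injective f}.
Proof.
elim: r => //= x r IHr /andP[xr /IHr inj] y z.
rewrite !inE => /predU1P[->|yr] /predU1P[->|zr] //; last exact: inj.
  by move=> xz; rewrite xz map_f in xr.
by move=> yx; rewrite -yx map_f in xr.
Qed.

Lemma traverses_inj_edge t C : traverses t C -> {in t &, injective fst}.
Proof. by case/and5P=> _ _ _ + _; apply: uniq_map_inj. Qed.

Lemma traverses_size t C : traverses t C -> size t = #|C|.
Proof.
case/and5P=> _ _ _ ut /eqP->.
by rewrite cardsE (card_uniqP ut) size_map.
Qed.

Lemma cyclesP C : reflect (exists t, traverses t C) (C \in cycles G).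
Proof.
rewrite inE; apply: (iffP existsP) => [[t tC]|[t tC]]; first by exists t.
by exists (tcast (traverses_size tC) (in_tuple t)); rewrite val_tcast.
Qed.

Lemma traverses_rot n t C : traverses t C -> traverses (rot n t) C.
Proof.
case/and5P=> t0 ct us ut /eqP->; apply/and5P.
rewrite -size_eq0 size_rot size_eq0 rot_cycle !map_rot !rot_uniq; split=> //.
by apply/eqP/setP => e; rewrite !inE mem_rot.
Qed.

(** Along a closed walk the targets are the sources, shifted by one. *)
Lemma traverses_tgts t C : traverses t C -> perm_eq (map dsrc t) (map dtgt t).
Proof.
move=> /traverses_dpath[u /dpath_srcs E].
by rewrite -(perm_cons u) -E perm_sym perm_rcons.
Qed.

Lemma ends_dart x : ends x.1 = [set dsrc x; dtgt x].
Proof. by rewrite /ends /dsrc /dtgt; case: x.2; rewrite // setUC. Qed.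

Lemma cycle_vertices_srcs t C v : traverses t C ->
  v \in cycle_vertices C -> v \in map dsrc t.
Proof.
move=> tC /bigcupP[e eC]; have [x xt <-] := traverses_dart tC eC.
rewrite ends_dart !inE => /orP[]/eqP->; first exact: map_f.
by rewrite (perm_mem (traverses_tgts tC)) map_f.
Qed.

Lemma traverses_next t C x : traverses t C -> x \in t ->
  exists2 y, y \in t & dsrc y = dtgt x.
Proof.
move=> tC xt; have : dtgt x \in map dsrc t.
  by rewrite (perm_mem (traverses_tgts tC)) map_f.
by case/mapP=> y yt ->; exists y.
Qed.

Lemma traverses_prev t C x : traverses t C -> x \in t ->
  exists2 y, y \in t & dtgt y = dsrc x.
Proof.
move=> tC xt; have : dsrc x \in map dtgt t.
  by rewrite -(perm_mem (traverses_tgts tC)) map_f.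
by case/mapP=> y yt ->; exists y.
Qed.

Lemma traverses_inj_src t C : traverses t C -> {in t &, injective dsrc}.
Proof. by case/and5P=> _ _ us _ _; apply: uniq_map_inj. Qed.

Lemma traverses_inj_tgt t C : traverses t C -> {in t &, injective dtgt}.
Proof.
move=> tC; apply: uniq_map_inj; rewrite -(perm_uniq (traverses_tgts tC)).
by case/and5P: tC.
Qed.

Hypothesis simpleG : simple_graph G.

Lemma simple_dart x : dsrc x != dtgt x.
Proof.
rewrite /dsrc /dtgt; have := simpleG.1 x.1.
by case: x.2; rewrite // eq_sym.
Qed.

(** The edges of D are closed under passing to the next edge of C: at the vertex
    where y ends, D has a second edge, which lies in C, and the only edges of C
    at that vertex are y and the next one. *)
Lemma subcycle_eq t s C D :
  traverses t C -> traverses s D -> D \subset C -> C \subset D.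
Proof.
move=> tC sD DC.
have step y z : y \in t -> z \in t -> dtgt y = dsrc z -> y.1 \in D -> z.1 \in D.
  move=> yt zt yz yD; have [w ws wy] := traverses_dart sD yD.
  (* w' is the neighbour of w in s at the end of y *)
  have [w' [w's w'w vw']] : exists w', [/\ w' \in s, w' != w & dtgt y \in ends w'.1].
    have : dtgt y \in ends w.1 by rewrite wy ends_dart !inE eqxx orbT.
    rewrite ends_dart !inE => /orP[]/eqP->.
      have [w' w's w'w] := traverses_prev sD ws; exists w'; split=> //.
        by apply: contraNneq (simple_dart w) => w'E; rewrite -w'w w'E.
      by rewrite ends_dart !inE w'w eqxx orbT.
    have [w' w's w'w] := traverses_next sD ws; exists w'; split=> //.
      by apply: contraNneq (simple_dart w) => w'E; rewrite -w'w w'E.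
    by rewrite ends_dart !inE w'w eqxx.
  have w'D := traverses_edge sD w's.
  have [y' y't y'w'] := traverses_dart tC (subsetP DC _ w'D).
  move: vw'; rewrite -y'w' ends_dart !inE => /orP[]/eqP yy'.
    have <- : y' = z by apply: (traverses_inj_src tC) => //; rewrite -yy'.
    by rewrite y'w'.
  have yE : y = y' by apply: (traverses_inj_tgt tC).
  case/eqP: w'w; apply: (traverses_inj_edge sD) => //.
  by rewrite wy -y'w' yE.
have [x xt xD] : exists2 x, x \in t & x.1 \in D.
  case/and5P: (sD); case: (s) => [//|w s' _ _ _ _ DE].
  have wD : w.1 \in D by rewrite (eqP DE) inE mem_head.
  by have [x xt xw] := traverses_dart tC (subsetP DC _ wD); exists x; rewrite ?xw.
have [n t' tE] := rot_to xt.
have : all (fun y => y.1 \in D) (x :: t').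
  have sub : {subset x :: t' <= t} by move=> y; rewrite -tE mem_rot.
  have [u] := traverses_dpath (traverses_rot n tC); rewrite tE /= xD.
  case/andP=> _; elim: t' x xt xD sub {tE} => //= y t' IHt x xt xD sub.
  have yt : y \in t by apply: sub; rewrite !inE eqxx orbT.
  case/andP=> /eqP yx yu; have yD := step x y xt yt (esym yx) xD.
  rewrite yD; apply: IHt yu => // z zt'.
  by apply: sub; rewrite in_cons zt' orbT.
rewrite -tE => /allP tD; apply/subsetP => e eC.
by have [y yt <-] := traverses_dart tC eC; apply: tD; rewrite mem_rot.
Qed.

(** The source of the first edge is not visited again, whereas both ends of
    every later edge are. *)
Lemma dpath_uniq_edges u t v : dpath u t v -> uniq (u :: map dtgt t) ->
  uniq (map fst t).
Proof.
elim: t u => [//|x t IHt] u /= /andP[/eqP xu xt].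
rewrite inE negb_or => /andP[/andP[_ ut] /andP[xt' uniqt]].
rewrite (IHt (dtgt x)) // ?andbT /= ?xt' //.
apply/mapP => -[y yt xy].
have : u \in ends y.1 by rewrite -xy ends_dart xu !inE eqxx.
have ux : u != dtgt x by rewrite -xu simple_dart.
have uv : u \notin dtgt x :: map dtgt t by rewrite inE negb_or ux.
rewrite -(dpath_srcs xt) mem_rcons inE negb_or in uv.
case/andP: uv => _ us; rewrite ends_dart !inE => /orP[]/eqP uy.
  by rewrite uy map_f in us.
by rewrite uy map_f in ut.
Qed.

End Walks.

(** * Edge values that come from functions on the vertices *)

Section Exact.
Variables (R : comNzRingType) (G : lgraph R).
Local Notation V := (vertex G).
Local Notation E := (edge G).
Local Notation dsrc := (@Defs.dsrc R G).
Local Notation dtgt := (@Defs.dtgt R G).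
Implicit Types (t s : seq (dart G)) (x y z : dart G) (C D S : {set E}).
Implicit Types (h : E -> R) (f : V -> R).

Definition signed h x : R := if x.2 then h x.1 else - h x.1.

Definition exact_on h S : Prop :=
  exists f, forall e, e \in S -> h e = f (src e) - f (tgt e).

Lemma signed_potential h f x :
  signed h x = f (dsrc x) - f (dtgt x) <-> h x.1 = f (src x.1) - f (tgt x.1).
Proof.
rewrite /signed /dsrc /dtgt; case: x.2 => //.
rewrite -[f (tgt _) - _]opprB; split; first exact: oppr_inj.
by move->.
Qed.

Lemma dpath_sum h f u t v : dpath u t v ->
  (forall x, x \in t -> h x.1 = f (src x.1) - f (tgt x.1)) ->
  \sum_(x <- t) signed h x = f u - f v.
Proof.
elim: t u => [|x t IHt] u /=; first by move/eqP->; rewrite big_nil subrr.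
case/andP=> /eqP <- xt hf; rewrite big_cons (IHt _ xt) => [|y yt].
  have /signed_potential -> := hf x (mem_head _ _).
  by rewrite addrA subrK.
by apply: hf; rewrite inE yt orbT.
Qed.

Lemma exact_sum h t C : traverses t C -> exact_on h C ->
  \sum_(x <- t) signed h x = 0.
Proof.
move=> tC [f fP]; have [u tu] := traverses_dpath tC.
rewrite (dpath_sum (f := f) tu) ?subrr // => x xt; apply: fP.
exact: traverses_edge tC xt.
Qed.

(** The potential is normalised to 0 at the start u of the path, which lets the
    first edge be prepended by a shift of the potential of the rest. *)
Lemma dpath_potential h u t v : dpath u t v -> uniq (u :: map dtgt t) ->
  exists f, forall x, x \in t -> h x.1 = f (src x.1) - f (tgt x.1).
Proof.
move=> tuv ut; suff [f _ fP] : exists2 f, f u = 0 &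
    forall x, x \in t -> signed h x = f (dsrc x) - f (dtgt x).
  by exists f => x /fP /signed_potential.
elim: t u tuv ut => [|x t IHt] u /=; first by exists (fun _ => 0).
move=> /andP[/eqP xu xt]; rewrite inE negb_or => /andP[/andP[ux ut] uxt].
have [f fx fP] := IHt _ xt uxt.
have uv : u \notin dtgt x :: map dtgt t by rewrite inE negb_or ux.
rewrite -(dpath_srcs xt) mem_rcons inE negb_or in uv; case/andP: uv => _ us.
exists (fun w => if w == u then 0 else f w - signed h x); rewrite ?eqxx // => y.
rewrite inE => /predU1P[->|yt].
  by rewrite xu eqxx eq_sym (negPf ux) fx !sub0r opprK.
rewrite !ifF; first by rewrite (fP y yt); ring.
  by apply: contraNF ut => /eqP <-; rewrite map_f.
by apply: contraNF us => /eqP <-; rewrite map_f.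
Qed.

(** Cut the cycle at its last edge: the potential of the remaining path is right
    on that edge too, because the sum around the cycle is 0. *)
Lemma sum_exact h t C : traverses t C -> \sum_(x <- t) signed h x = 0 ->
  exact_on h C.
Proof.
move=> tC; have [u tu] := traverses_dpath tC.
have eC e : (e \in C) = (e \in map fst t) by apply: traverses_mem.
case/and5P: tC => _ _; case/lastP: t tu eC => [|t x] tu eC us _ _.
  by exists (fun _ => 0) => e; rewrite eC.
rewrite -cats1 in tu; have [v tuv /=] := dpath_cat tu.
case/andP=> /eqP xv /eqP xu.
have ut : uniq (u :: map dtgt t) by rewrite -(dpath_srcs tuv) -xv -map_rcons.
have [f fP] := dpath_potential h tuv ut.
rewrite -cats1 big_cat big_seq1 /= (dpath_sum tuv fP) => /eqP.
rewrite addr_eq0 -subr_eq0 opprK => /eqP hx; exists f => e.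
rewrite eC map_rcons mem_rcons inE => /predU1P[->|/mapP[y /fP hy ->//]].
apply/signed_potential; rewrite xv xu; apply/eqP.
by rewrite -subr_eq0 opprB addrC hx.
Qed.

Hypothesis simpleG : simple_graph G.

(** The ends of e cut the cycle into two arcs, each closed up by e.  The two
    cycles are shorter than C because an arc with a single edge would be
    parallel to e. *)
Lemma chord_cycles t C e : traverses t C -> e \notin C ->
  src e \in cycle_vertices C -> tgt e \in cycle_vertices C ->
  exists t1 t2 C1 C2,
    [/\ perm_eq t (t1 ++ t2), traverses (rcons t1 (e, false)) C1,
        traverses (rcons t2 (e, true)) C2 & (#|C1| < #|C|)%N /\ (#|C2| < #|C|)%N].
Proof.
move=> tC eC uC vC.
have [x xt xu] : exists2 x, x \in t & dsrc x = src e.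
  by have /mapP[x xt ->] := cycle_vertices_srcs tC uC; exists x.
have [n t' tE] := rot_to xt.
have := traverses_rot n tC; rewrite tE => {}tC.
have [y yt yv] : exists2 y, y \in x :: t' & dsrc y = tgt e.
  by have /mapP[y yt ->] := cycle_vertices_srcs tC vC; exists y.
have {yt} : y \in t'.
  move: yt; rewrite inE => /predU1P[yx|//]; case/eqP: (simpleG.1 e).
  by rewrite -xu -yv yx.
move=> yt; case/path.splitPr: yt tE tC => p1 p2 tE tC.
have [w tw] := traverses_dpath tC.
have wu : w = src e by move: tw => /= /andP[/eqP <-].
rewrite wu -cat_cons in tw; have [v p1v p2u] := dpath_cat tw.
have ve : v = tgt e by move: (p2u) => /= /andP[/eqP <-].
rewrite {v}ve in p1v p2u.
have [us ut] : uniq (map dsrc (x :: p1) ++ map dsrc (y :: p2)) /\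
    uniq (map fst (x :: p1) ++ map fst (y :: p2)).
  by rewrite -!map_cat; case/and5P: tC.
have notin z : z \in x :: p1 ++ y :: p2 -> z.1 != e.
  by move=> /(traverses_edge tC) zC; apply: contraNneq eC => <-.
have eN : e \notin map fst (x :: p1) ++ map fst (y :: p2).
  by rewrite -map_cat; apply/mapP => -[z /notin /eqP zN zE]; apply: zN.
have size2 z a b : z \in x :: p1 ++ y :: p2 -> [set a; b] = ends e ->
    dsrc z = a -> dtgt z != b.
  move=> /notin /eqP zN ab za; apply/eqP => zb; apply: zN.
  by apply: simpleG.2; rewrite ends_dart za zb.
exists (x :: p1), (y :: p2), [set e' in map fst (rcons (x :: p1) (e, false))],
  [set e' in map fst (rcons (y :: p2) (e, true))].
rewrite mem_cat negb_or in eN; case/andP: eN => eN1 eN2.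
move: (us) (ut); rewrite !cat_uniq => /and3P[us1 us12 us2] /and3P[ut1 _ ut2].
have tC1 : traverses (rcons (x :: p1) (e, false))
    [set e' in map fst (rcons (x :: p1) (e, false))].
  apply: (@dpath_traverses _ _ (src e)) => //.
  - exact: (@dpath_rcons _ _ _ _ (e, false)).
  - rewrite map_rcons rcons_uniq us1 andbT.
    by apply: contra us12 => eN; apply/hasP; exists (tgt e); rewrite //= yv mem_head.
  - by rewrite map_rcons rcons_uniq eN1.
have tC2 : traverses (rcons (y :: p2) (e, true))
    [set e' in map fst (rcons (y :: p2) (e, true))].
  apply: (@dpath_traverses _ _ (tgt e)) => //.
  - exact: (@dpath_rcons _ _ _ _ (e, true)).
  - rewrite map_rcons rcons_uniq us2 andbT.
    apply: contra us12 => eN; apply/hasP; exists (src e) => //=.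
    by rewrite xu mem_head.
  - by rewrite map_rcons rcons_uniq eN2.
split=> //; first by rewrite -(perm_rot n) tE.
rewrite -(traverses_size tC1) -(traverses_size tC2) -(traverses_size tC).
rewrite !size_rcons /= !ltnS size_cat /= addnS !ltnS; split.
  rewrite -addn1 leq_add2l; case: (p2) p2u size2 => //= /andP[_ yu] /(_ y (tgt e) (src e)).
  by rewrite yu -cat_cons mem_cat mem_head orbT => H; have := H isT (setUC _ _) yv.
rewrite addnC -{1}[size p2]addn0 ltn_add2l.
case: (p1) p1v size2 => //= /andP[_ xv] /(_ x (src e) (tgt e)).
by rewrite xv mem_head => H; have := H isT erefl xu.
Qed.

(** A smaller cycle on the vertices of C is not contained in C by
    [subcycle_eq], so it provides a chord.  The two cycles that the chord
    creates traverse it in opposite directions, hence its contributions cancel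
    in the sum of the two. *)
Lemma exact_on_cycles h :
  (forall C, C \in minimal_cycles G -> exact_on h C) ->
  forall C, C \in cycles G -> exact_on h C.
Proof.
move=> hmin C; have [n] := ubnP #|C|; elim: n C => // n IHn C.
rewrite ltnS => Cn CG; have [Cmin|] := boolP (C \in minimal_cycles G).
  exact: hmin.
rewrite inE CG /= => /forall_inPn[D DG]; rewrite negb_imply negbK.
case/andP=> DC vDC.
have /cyclesP[t tC] := CG; have /cyclesP[s sD] := DG.
have /subsetPn[e eD eC] : ~~ (D \subset C).
  apply: contraL DC => DC; rewrite -leqNgt.
  by rewrite subset_leq_card //; apply: (subcycle_eq simpleG tC sD).
have ev w : w \in ends e -> w \in cycle_vertices C.
  by move=> we; apply: (subsetP vDC); apply/bigcupP; exists e.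
have [||t1 [t2 [C1 [C2 [tt tC1 tC2 [C1C C2C]]]]]] := chord_cycles tC eC.
- by apply: ev; rewrite !inE eqxx.
- by apply: ev; rewrite !inE eqxx orbT.
have hC1 : exact_on h C1.
  by apply: IHn; [exact: leq_trans C1C Cn | apply/cyclesP; exists (rcons t1 (e, false))].
have hC2 : exact_on h C2.
  by apply: IHn; [exact: leq_trans C2C Cn | apply/cyclesP; exists (rcons t2 (e, true))].
apply: (sum_exact tC); rewrite (perm_big _ tt) big_cat /=.
have := congr2 +%R (exact_sum tC1 hC1) (exact_sum tC2 hC2).
by rewrite -!cats1 !big_cat !big_seq1 /= /signed /= addrACA addNr !addr0.
Qed.

Definition adjacent S : rel V := fun u v =>
  [exists x : dart G, [&& x.1 \in S, dsrc x == u & dtgt x == v]].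

Lemma adjacent_dpath S u p : path (adjacent S) u p ->
  exists t, [/\ map dtgt t = p, dpath u t (last u p) & {subset map fst t <= S}].
Proof.
elim: p u => [|v p IHp] u /=; first by exists [::]; split=> /=.
case/andP=> /existsP[x /and3P[xS /eqP xu /eqP xv]] /IHp[t [<- tv tS]].
exists (x :: t); rewrite /= xu xv eqxx; split=> // e.
by rewrite inE => /predU1P[->|/tS].
Qed.

Lemma adjacent_edge S e : e \in S ->
  adjacent S (src e) (tgt e) /\ adjacent S (tgt e) (src e).
Proof.
move=> eS; split; apply/existsP; first by exists (e, true); rewrite /= eS !eqxx.
by exists (e, false); rewrite /= eS !eqxx.
Qed.

(** Induction on S.  Let f be a potential off the edge e.  If the ends of e are
    connected without e, then e closes a path to a cycle and f is right on e;
    otherwise f can be shifted on the component of one end. *)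
Lemma exact_from_cycles h S :
  (forall C, C \in cycles G -> C \subset S -> exact_on h C) -> exact_on h S.
Proof.
have [n] := ubnP #|S|; elim: n S => // n IHn S; rewrite ltnS => Sn hS.
have [->|/set0Pn[e eS]] := eqVneq S set0.
  by exists (fun _ => 0) => e; rewrite inE.
pose S' := S :\ e; have S'S : S' \subset S by apply: subsetDl.
have [|C CG CS'|f fP] := IHn S'.
- by apply: leq_trans Sn; apply: proper_card; apply: properD1.
- by apply: hS => //; apply: subset_trans S'S.
have SE e' : e' \in S -> e' = e \/ e' \in S'.
  by move=> e'S; have [->|e'e] := eqVneq e' e; [left | right; rewrite !inE e'e].
have [uv|uv] := boolP (connect (adjacent S') (src e) (tgt e)).
  have [p pP vE] := connectP uv; case/shortenP: pP vE => p' p'P up' _ vE.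
  have [t [tp' tv tS']] := adjacent_dpath p'P; rewrite -vE in tv.
  have tC : traverses (rcons t (e, false)) [set e' in map fst (rcons t (e, false))].
    apply: (@dpath_traverses _ _ (src e)).
    - by case: (t).
    - exact: (@dpath_rcons _ _ _ _ (e, false)).
    - by rewrite map_rcons /= (dpath_srcs tv) tp'.
    rewrite map_rcons rcons_uniq; apply/andP; split.
      by apply/negP => /tS'; rewrite !inE eqxx.
    by apply: dpath_uniq_edges tv _; rewrite ?tp'.
  exists f => e' /SE[->|/fP //].
  have /(exact_sum tC) : exact_on h [set e' in map fst (rcons t (e, false))].
    apply: hS; first by apply/cyclesP; exists (rcons t (e, false)).
    apply/subsetP => e''; rewrite inE map_rcons mem_rcons inE.
    by case/predU1P => [->|/tS' /(subsetP S'S)].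
  rewrite -cats1 big_cat big_seq1 /= (dpath_sum (f := f) tv); last first.
    by move=> x xt; apply: fP; apply/tS'/map_f.
  by move/subr0_eq.
pose f' w := f w + if connect (adjacent S') (src e) w
  then h e - f (src e) + f (tgt e) else 0.
exists f' => e' /SE[->|e'S'].
  by rewrite /f' connect0 (negPf uv); ring.
have [a1 a2] := adjacent_edge e'S'; rewrite (fP _ e'S') /f'.
suff -> : connect (adjacent S') (src e) (src e') =
    connect (adjacent S') (src e) (tgt e') by ring.
by apply/idP/idP => c; apply: connect_trans c (connect1 _).
Qed.

End Exact.

(** * Splines as an extension *)

Section Splines.
Variables (R : idomainType) (G : lgraph R).
Local Notation V := (vertex G).
Local Notation E := (edge G).
Local Notation spline := (@Defs.spline R G).
Hypothesis simpleG : simple_graph G.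

Definition coboundary (f : {ffun V -> R^o}) : {ffun E -> R^o} :=
  [ffun e => f (src e) - f (tgt e)].

Lemma coboundary_is_linear : linear coboundary.
Proof.
by move=> c f g; apply/ffunP => e; rewrite !ffunE opprD addrACA -scalerBr.
Qed.

HB.instance Definition _ :=
  GRing.isLinear.Build R _ _ _ coboundary coboundary_is_linear.

Definition label_mul (g : {ffun E -> R^o}) : {ffun E -> R^o} :=
  [ffun e => lab e * g e].

Lemma label_mul_is_linear : linear label_mul.
Proof.
by move=> c f g; apply/ffunP => e; rewrite !ffunE mulrDr mulrCA.
Qed.

HB.instance Definition _ :=
  GRing.isLinear.Build R _ _ _ label_mul label_mul_is_linear.

(** The coefficient of an edge of label 0 is arbitrary; dropping these columns
    makes the coefficient vector of a spline unique. *)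
Definition nonzero_edges : {set E} := [set e | lab e != 0].

(** Restriction to one representative per component is an isomorphism onto a
    coordinate space. *)
Lemma locally_constant_free :
  finite_free (fun f : {ffun V -> R^o} => coboundary f = 0).
Proof.
pose r := fingraph.root (adjacent [set: E]).
have symA : connect_sym (adjacent [set: E]).
  apply: sym_connect_sym => u v; apply/existsP/existsP => -[x /and3P[_ xu xv]];
    exists (x.1, ~~ x.2); move: xu xv; rewrite /dsrc /dtgt inE /=;
    by case: x.2 => -> ->.
pose T (c : {ffun V -> R^o}) : {ffun V -> R^o} := [ffun v => c (r v)].
have Tlin : linear T by move=> a c c'; apply/ffunP => v; rewrite !ffunE.
pose TL := GRing.isLinear.Build R _ _ _ T Tlin.
pose T' : {linear {ffun V -> R^o} -> {ffun V -> R^o}} := HB.pack T TL.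
have rr v : r (r v) = r v by apply: root_root.
apply: (@finite_free_image _ _ _ T' (supported [set v | r v == v])); last first.
- exact: finite_free_supported.
- move=> f; split=> [/ffunP f0|[c _ ->]]; last first.
    apply/ffunP => e; rewrite !ffunE; apply/eqP; rewrite subr_eq0; apply/eqP.
    congr (c _); apply/eqP; rewrite root_connect //; apply: connect1.
    by case: (adjacent_edge (in_setT e)).
  have fr v : f (r v) = f v.
    have cl : closed (adjacent [set: E]) [pred w | f w == f v].
      move=> u w /existsP[x /and3P[_ /eqP <- /eqP <-]]; rewrite !inE.
      have := f0 x.1; rewrite !ffunE => /subr0_eq.
      by rewrite /dsrc /dtgt; case: x.2 => ->.
    by have /(closed_connect cl) := connect_root (adjacent [set: E]) v;
      rewrite !inE eqxx => /esym/eqP.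
  exists (proj_on [set v | r v == v] f).
    by move=> v /negPf vr; rewrite ffunE vr.
  by apply/ffunP => v; rewrite !ffunE inE rr eqxx fr.
move=> c cr /ffunP T0; apply/ffunP => v; rewrite [RHS]ffunE.
have [/[!inE] /eqP rv|/cr //] := boolP (v \in [set v | r v == v]).
by have := T0 v; rewrite !ffunE rv.
Qed.

Variable tau : {set E} -> seq (dart G).
Hypothesis dirtau : directions tau.

(** The signs in the matrix are those of the traversal [tau], so a row of the
    matrix computes the sum around its cycle. *)
Lemma row_sum (i : row_index G) (g : {ffun E -> R^o}) :
  val i \in minimal_cycles G ->
  \sum_e graph_matrix tau (incidence0 G) i e * g e
    = \sum_(x <- tau (val i)) signed (label_mul g) x.
Proof.
move=> /dirtau tC.
have ut : uniq (map fst (tau (val i))) by case/and5P: tC.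
transitivity (\sum_(e <- map fst (tau (val i)))
    graph_matrix tau (incidence0 G) i e * g e).
  rewrite [LHS](bigID (mem (val i))) /= [X in _ + X]big1 ?addr0 => [|e /negPf eC].
    rewrite [RHS]big_uniq //=; apply: eq_bigl => e.
    exact: traverses_mem tC.
  by rewrite /graph_matrix ffunE eC mul0r.
rewrite big_map big_seq [RHS]big_seq; apply: eq_bigr => x xt.
rewrite /graph_matrix ffunE (traverses_edge tC xt) /signed !ffunE.
suff -> : ((x.1, true) \in tau (val i)) = x.2 by case: x.2; rewrite // mulNr.
apply/idP/idP => [xt'|x2]; last by rewrite -x2 -surjective_pairing.
by have := traverses_inj_edge tC xt xt' erefl => ->.
Qed.

Lemma row_cycles_minimal C : C \in minimal_cycles G ->
  row_cycles G = minimal_cycles G.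
Proof. by move=> CG; rewrite /row_cycles; case: eqP => // C0; rewrite C0 inE in CG. Qed.

Lemma row_cyclesP C : C \in row_cycles G -> C \in minimal_cycles G \/ C = set0.
Proof.
rewrite /row_cycles; case: ifP => _; last by left.
by rewrite inE => /eqP; right.
Qed.

(** The dummy row of a graph without cycles is zero and imposes no condition. *)
Lemma relations_exact (g : {ffun E -> R^o}) :
  (forall i, i \in enum (row_index G) ->
     \sum_e graph_matrix tau (incidence0 G) i e * g e = 0) <->
  exact_on (label_mul g) setT.
Proof.
split=> [row0|gex i _].
  apply: exact_from_cycles => // C CG _; apply: exact_on_cycles => // {CG}C CG.
  apply: (sum_exact (dirtau CG)).
  have CR : C \in row_cycles G by rewrite (row_cycles_minimal CG).
  by rewrite -(row_sum (i := Sub C CR)) ?row0 ?mem_enum ?SubK.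
have [CG|C0] := row_cyclesP (valP i).
  rewrite row_sum // (exact_sum (dirtau CG)) //.
  by case: gex => f fP; exists f => e _; apply: fP; rewrite inE.
by apply: big1 => e _; rewrite /graph_matrix ffunE C0 inE mul0r.
Qed.

Lemma splineP (f : {ffun V -> R^o}) :
  f \in spline <-> exists2 g, supported nonzero_edges g & coboundary f = label_mul g.
Proof.
split=> [/asboolP fS|[g _ fg]].
  have /choice[g gP] : forall e, exists c, f (src e) - f (tgt e) = lab e * c.
    move=> e; have /asboolP[c ->] := fS e; exists (c e).
    by rewrite big_set1 mulrC.
  exists (proj_on nonzero_edges [ffun e => g e]).
    by move=> e /negPf eN; rewrite ffunE eN.
  apply/ffunP => e; rewrite !ffunE gP inE.
  by case: eqVneq => [->|]; rewrite ?mul0r.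
apply/asboolP => e; apply/asboolP; exists (fun => g e); rewrite big_set1.
by have /ffunP/(_ e) := fg; rewrite !ffunE mulrC.
Qed.

(** The coboundary maps the splines onto the values [lab e * g e] with g in the
    kernel of the matrix, and multiplication by nonzero labels is injective. *)
Lemma spline_finite_free :
  finite_free (relations (graph_matrix tau (incidence0 G)) (enum (row_index G))
    nonzero_edges) ->
  finite_free (fun f : {ffun V -> R^o} => f \in spline).
Proof.
move=> freeK.
pose Q (h : {ffun E -> R^o}) := exists2 g,
  relations (graph_matrix tau (incidence0 G)) (enum (row_index G)) nonzero_edges g
  & h = label_mul g.
have freeQ : finite_free Q.
  apply: (@finite_free_image _ _ _ label_mul _ Q _ _ freeK) => // g [gN _] /ffunP g0.
  apply/ffunP => e; rewrite [RHS]ffunE.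
  have [/[!inE] le|/gN //] := boolP (e \in nonzero_edges).
  by have /eqP := g0 e; rewrite !ffunE mulf_eq0 (negPf le) => /eqP.
apply: (@finite_free_extension _ _ _ coboundary _ Q) freeQ.
- move=> a f g fS gS; exact: (spline_submod G).2.
- move=> f /splineP[g gN fg]; exists g => //; split=> //.
  apply/relations_exact; exists f => e _.
  by have /ffunP/(_ e) := fg; rewrite !ffunE => <-.
- move=> _ [g [gN /relations_exact[f fP]] ->].
  have fg : coboundary (finfun f) = label_mul g.
    by apply/ffunP => e; rewrite [LHS]ffunE !(ffunE f) fP // inE.
  by exists (finfun f) => //; apply/splineP; exists g.
apply: finite_free_iff locally_constant_free => f; split=> [f0|[]//].
split=> //; apply/splineP; exists 0; first by move=> e _; rewrite ffunE.
by rewrite f0 linear0.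
Qed.

End Splines.

Lemma free_spline_module (R : comNzRingType) (G : lgraph R) :
  finite_free (fun f : {ffun vertex G -> R^o} => f \in @spline R G) ->
  free_module (spline_module G).
Proof.
case=> I [b [bP bI]].
have bS i : b i \in @spline R G.
  apply/bP; exists (fun j => (j == i)%:R).
  rewrite (bigD1 i) //= eqxx scale1r big1 ?addr0 // => j /negPf ->.
  by rewrite scale0r.
have sumE (s : seq I) (c : I -> R) :
    val (\sum_(i <- s) c i *: Spline (bS i)) = \sum_(i <- s) c i *: b i.
  by rewrite raddf_sum; apply: eq_bigr.
exists I, (fun i => Spline (bS i)); split=> [x|s c us s0 i si].
  have /bP[c xc] : val x \in @spline R G by apply: valP.
  exists (enum I), c; apply/val_inj; rewrite sumE xc.
  by rewrite big_enum.
have := bI (fun j => if j \in s then c j else 0).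
have -> : \sum_j (if j \in s then c j else 0) *: b j = 0.
  transitivity (\sum_(j <- s) c j *: b j); last by rewrite -sumE s0.
  rewrite [RHS]big_uniq //= [RHS]big_mkcond.
  by apply: eq_bigr => j _; case: ifP => // _; rewrite scale0r.
by move=> /(_ erefl i); rewrite si.
Qed.

(** * Removals and decompositions *)

Section Removal.
Variables (R : idomainType) (G : lgraph R).
Local Notation E := (edge G).
Variable tau : {set E} -> seq (dart G).

(** If l_e is the sum of the c_j l_j, the signs s of the matrix turn the column
    combination into s_e s_j c_j.  The columns j are zero outside the row C,
    since j is exterior, and e is not among them, since e is interior.  The
    coefficients of columns with label 0 are set to 0: they contribute nothing,
    and the operation stays within the columns of nonzero label. *)
Lemma removal_free I C e : removable I C e ->
  finite_free (relations (graph_matrix tau (remove I C e)) (enum (row_index G))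
    (nonzero_edges G)) ->
  finite_free (relations (graph_matrix tau I) (enum (row_index G)) (nonzero_edges G)).
Proof.
case=> CG eC eint /asboolP[c lE]; set X := [set j in I C | exterior I j] in lE.
pose s j : R := if (j, true) \in tau C then 1 else -1.
have ss j : s j * s j = 1 by rewrite /s; case: ifP; rewrite ?mulrNN mulr1.
pose d j := if (j \in X) && (lab j != 0) then s e * s j * c j else 0.
have rowC (i : row_index G) j : val i = C -> j \in I C ->
    graph_matrix tau I i j = s j * lab j.
  by move=> iC jC; rewrite /graph_matrix iC jC /s; case: ifP; rewrite ?mul1r ?mulN1r.
have dC (i : row_index G) : val i = C ->
    \sum_j graph_matrix tau I i j * d j = s e * lab e.
  move=> iC; rewrite lE mulr_sumr [RHS]big_mkcond; apply: eq_bigr => j _.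
  rewrite [_ *: _](_ : _ = c j * lab j) //.
  rewrite /d; case: (boolP (j \in X)) => [jX|_] /=; last by rewrite mulr0.
  have jC : j \in I C by move: jX; rewrite inE => /andP[].
  rewrite rowC //; have [->|_] := eqVneq (lab j) 0; first by rewrite !mulr0.
  rewrite /=; transitivity (s j * s j * (s e * (c j * lab j))); first by ring.
  by rewrite ss mul1r.
have dN (i : row_index G) : val i != C ->
    \sum_j graph_matrix tau I i j * d j = 0.
  move=> iC; apply: big1 => j _; rewrite /d.
  case: (boolP (j \in X)) => [|_] /=; last by rewrite mulr0.
  rewrite inE => /andP[jC /cards1P[D DE]].
  have iG : val i \in minimal_cycles G by rewrite -(row_cycles_minimal CG) (valP i).
  have CD : C \in [set D] by rewrite -DE inE CG.
  rewrite /graph_matrix; case: ifP => [ji|_]; last by rewrite mul0r.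
  have : val i \in [set D] by rewrite -DE inE iG.
  by move/set1P: CD iC => ->; rewrite inE => /negPf ->.
apply: (@column_operation_free _ _ _ _ _ _ _ e d).
- by rewrite /d inE /exterior; move: eint; rewrite /interior; case: eqP => [->|]; rewrite ?andbF.
- by move=> j; rewrite inE negbK /d => /eqP ->; rewrite eqxx andbF.
move=> i j _; have [iC|iC] := eqVneq (val i) C; last first.
  by rewrite dN // mulr0 subr0 /graph_matrix ffunE (negPf iC).
rewrite dC //; have [->|je] := eqVneq j e.
  by rewrite mul1r rowC // subrr /graph_matrix iC ffunE eqxx !inE eqxx.
by rewrite mul0r subr0 /graph_matrix ffunE iC eqxx !inE je.
Qed.

Lemma removals_free I I' : removals I I' ->
  finite_free (relations (graph_matrix tau I') (enum (row_index G)) (nonzero_edges G)) ->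
  finite_free (relations (graph_matrix tau I) (enum (row_index G)) (nonzero_edges G)).
Proof. by elim=> // I0 C e I1 rem _ IH /IH; apply: removal_free. Qed.

End Removal.

Section Rank.
Variables (k : fieldType) (d : nat) (H : lgraph {mpoly k[d]}).
Local Notation E := (edge H).

(** A basis with fewer than two elements is padded with zeros. *)
Lemma rank2_labels (C : {set E}) : cycle_rank_le C 2 ->
  exists p q, forall e, e \in C ->
    exists x y : k, lab e = x%:MP * p + y%:MP * q.
Proof.
case=> r [b [bspan _]] r2.
pose L := [seq val (b i) | i <- enum 'I_r].
have LE (i : 'I_r) : val (b i) = L`_i.
  by rewrite (nth_map i) ?size_enum_ord // nth_ord_enum.
exists L`_0, L`_1 => e eC.
have lC : (lab e : ({mpoly k[d]} : lmodType k)) \in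
    lspan (@lab _ H : E -> ({mpoly k[d]} : lmodType k)) C.
  apply/asboolP; exists (fun j => (j == e)%:R).
  rewrite (bigD1 e) //= eqxx scale1r big1 ?addr0 // => j /andP[_ /negPf ->].
  by rewrite scale0r.
have [s [c cE]] := bspan (LSpan lC).
have -> : lab e = val (\sum_(i <- s) c i *: b i) by rewrite -cE.
rewrite raddf_sum.
apply: (big_ind (fun z => exists x y : k, z = x%:MP * L`_0 + y%:MP * L`_1)).
- by exists 0, 0; rewrite mpolyC0 !mul0r addr0.
- move=> _ _ [x [y ->]] [x' [y' ->]]; exists (x + x'), (y + y').
  by rewrite !mpolyCD; ring.
move=> i _.
suff : exists x y : k, c i *: val (b i) = x%:MP * L`_0 + y%:MP * L`_1 by [].
rewrite LE -mul_mpolyC.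
have i2 := leq_trans (ltn_ord i) r2.
case: (nat_of_ord i) i2 => [|[|//]] _.
  by exists (c i), 0; rewrite mpolyC0 mul0r addr0.
by exists 0, (c i); rewrite mpolyC0 mul0r add0r.
Qed.

Variables (s p : nat) (C : 'I_s -> {set E}).
Hypothesis disjH : disjoint_cycles_and_free_edges C p.

(** Only one inclusion is available: a cycle of H need not be minimal, since a
    loop at one of its vertices is a smaller cycle. *)
Lemma row_cycle_cases (i : row_index H) : val i = set0 \/ exists a, val i = C a.
Proof.
case: (row_cyclesP (valP i)) => [|->]; last by left.
by rewrite inE => /andP[/(proj1 (let: And3 h _ _ := disjH in h _)) iC _]; right.
Qed.

Variable tau : {set E} -> seq (dart H).
Local Notation B := (graph_matrix tau (incidence0 H)).

Lemma row_outside (i : row_index H) e : e \notin val i -> B i e = 0.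
Proof. by move=> /negPf ei; rewrite /graph_matrix ffunE ei. Qed.

Lemma rows_disjoint (i i' : row_index H) e : i != i' -> B i e = 0 \/ B i' e = 0.
Proof.
move=> ii'; have [ei|/row_outside] := boolP (e \in val i); last by left.
right; apply: row_outside; have ii'v : val i != val i' by rewrite (inj_eq val_inj).
case: (row_cycle_cases i) ei => [->|[a iE]]; first by rewrite inE.
case: (row_cycle_cases i') => [->|[a' i'E]]; first by rewrite inE.
rewrite iE i'E in ii'v *; have aa' : a != a' by apply: contraNneq ii'v => ->.
by case: disjH => _ /(_ _ _ aa') /disjointFr dis _ ea; rewrite (dis e ea).
Qed.

Hypothesis rankC : forall i, cycle_rank_le (C i) 2.

Lemma row_rank2 (i : row_index H) : exists q q', forall e,
  exists x y : k, B i e = x%:MP * q + y%:MP * q'.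
Proof.
have out q q' e : e \notin val i -> exists x y : k, B i e = x%:MP * q + y%:MP * q'.
  by move=> /row_outside ->; exists 0, 0; rewrite mpolyC0 !mul0r addr0.
case: (row_cycle_cases i) => [i0|[a iE]].
  by exists 0, 0 => e; apply: out; rewrite i0 inE.
have [q [q' qq']] := rank2_labels (rankC a).
exists q, q' => e; have [ei|/out //] := boolP (e \in val i).
have [|x [y lE]] := qq' e; first by rewrite -iE.
rewrite /graph_matrix ffunE ei lE; case: ifP => _; first by exists x, y.
by exists (- x), (- y); rewrite !mpolyCN; ring.
Qed.

End Rank.

Theorem corollary5p8 (k : fieldType) (d : nat) (G : lgraph {mpoly k[d]})
    (simpleG : simple_graph G) :
  (forall C : {set edge G},
      cycles G = [set C]%SET -> cycle_rank_le C 2 ->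
      free_module (spline_module G))
  /\
  (forall (H : lgraph {mpoly k[d]}) (s p : nat) (C : 'I_s -> {set edge H}),
      decomposes G H -> disjoint_cycles_and_free_edges C p ->
      (forall i : 'I_s, cycle_rank_le (C i) 2) ->
      free_module (spline_module G)).
Proof.
set partb := (X in _ /\ X); suff b : partb.
  split=> // C CG rankC; have Ccyc D : D \in cycles G <-> exists i : 'I_1, D = C.
    rewrite CG inE; split=> [/eqP|[_ ->] //]; by exists ord0.
  apply: (b G 1%N #|~: C| (fun=> C)) => //; last first.
    by split=> // [i j|]; [rewrite !ord1 eqxx | rewrite big_ord1].
  have /choice[tau tauP] : forall D, exists t : seq (dart G),
      D \in minimal_cycles G -> traverses t D.
    move=> D; have [|_] := boolP (D \in minimal_cycles G); last by exists [::].
    by rewrite inE => /andP[/cyclesP[t tD] _]; exists t.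
  exists (incidence0 G), tau, tau; split=> //; first exact: removals_refl.
  by exists id, id; split=> //; exists id.
move=> H s p C [I [tau [tau' [rem dtau _ [f [g [bijf _ AB]]]]]]] disjH rankC.
apply/free_spline_module/(spline_finite_free simpleG dtau)/(removals_free rem).
apply: disjoint_rows_free; first exact: enum_uniq.
  move=> i i' j ii'; rewrite -!AB; apply: (rows_disjoint disjH).
  by rewrite (inj_eq (bij_inj bijf)).
move=> i S'; have [q [q' qq']] := row_rank2 disjH tau' rankC (f i).
apply: (rank2_row_free (@reducible_pairs_mpoly k d) (phi := @mpolyC d k)) => j _.
by rewrite -AB; apply: qq'.
Qed.
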